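(* Let $n\geq 2$ be an integer and $\xi$ a transcendental real number. Then \[ \widehat{w}_{n}(\xi)\leq n-\frac{1}{2}+\sqrt{n^{2}-2n+\frac{5}{4}}. \] Moreover, for $n=3$ one has the stronger estimate $\widehat{w}_{3}(\xi)\leq 3+\sqrt{2}$.
   Context: The height $H(P)$ of an integer polynomial $P$ is the maximum of the absolute values of its coefficients. For a real number $\xi$ and integer $n\ge1$, $\widehat{w}_{n}(\xi)$ is the supremum of the real numbers $w$ such that for all sufficiently large $H$ the system $0<|P(\xi)|\le H^{-w}$, $H(P)\le H$, has a solution $P\in\mathbb{Z}[X]$ of degree at most $n$. *)

(* Defs.v *)
From HB Require Import structures.
From mathcomp Require Import all_boot all_order all_algebra.
From mathcomp Require Import all_classical all_reals all_analysis.

Set Implicit Arguments.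
Unset Strict Implicit.
Unset Printing Implicit Defensive.

Import Order.TTheory GRing.Theory Num.Theory.
Import numFieldNormedType.Exports.

Local Open Scope classical_set_scope.
Local Open Scope ring_scope.

Definition height (P : {poly int}) : nat :=
  (\max_(i < size P) absz (P`_i)%R)%N.

Definition transcendental (R : realType) (xi : R) : Prop :=
  ~ algebraicOver (ratr : rat -> R) xi.

(* H ranges over the reals, not only the integers *)
Definition uniformly_approximable (R : realType) (n : nat) (xi w : R) : Prop :=
  \forall H \near +oo, exists P : {poly int},
    [/\ (size P <= n.+1)%N,
        (height P)%:R <= H,
        0 < `|(map_poly intr P).[xi]|
      & `|(map_poly intr P).[xi]| <= H `^ (- w)].

(* the supremum is taken in the extended reals, so that no boundedness is
   presupposed *)
Definition uniform_exponent (R : realType) (n : nat) (xi : R) : \bar R :=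
  ereal_sup [set w%:E | w in [set w : R | uniformly_approximable n xi w]].

(* Main.v *)
Require Import Defs.
From HB Require Import structures.
From mathcomp Require Import all_boot all_order all_algebra.
From mathcomp Require Import all_classical all_reals all_analysis.
From mathcomp Require Import perm zify ring lra.

Set Implicit Arguments.
Unset Strict Implicit.
Unset Printing Implicit Defensive.

Import Order.TTheory GRing.Theory Num.Theory.
Import numFieldNormedType.Exports.

Local Open Scope classical_set_scope.
Local Open Scope ring_scope.

(** Suppose the exponent x is uniformly achieved in degree n = p + 1 and x > 2 n - 2.
    A lower bound |Q(xi)| >> H(Q)^(2 - 2 n) for all Q of degree less than n
    (resultants and Gelfond's inequality) makes the successive minimal polynomials
    P_k of degree exactly n, with P_k and P_{k+1} coprime.  Write h_k for
    log H(P_k) and l_k for - log |P_k(xi)|, so that l_k >= x h_{k+1} - O(1).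
    - The resultant of P_k and P_{k+1} gives (x - n) h_{k+1} <= (n - 1) h_k + O(1).
    - If P_k, P_{k+1}, P_{k+2} are linearly independent, which happens infinitely
      often, then some X^m P_k is independent of the X^i P_{k+1} and X^i P_{k+2}
      (i < n - 1) among polynomials of degree at most 2 n - 2; the determinant of
      this family gives x h_{k+1} <= (n - 1) (h_{k+1} + h_{k+2}) + O(1).
    Together, (x - n) (x - n + 1) <= (n - 1)^2, which is the general bound.
    For n = 3 the second estimate is replaced by the determinant of four
    independent minimal polynomials coming from two consecutive independent
    triples; between them all minimal polynomials lie in one plane, where
    |P_k(xi)| H(P_{k+1}) is constant up to a bounded factor. *)

(** * Determinants bounded row by row *)

Section Determinants.
Variable R : realDomainType.

Lemma normr_det_le (d : nat) (M : 'M[R]_d) (h : 'I_d -> R) :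
  (forall i j, `|M i j| <= h i) -> `|\det M| <= d`!%:R * \prod_i h i.
Proof.
move=> Mh; rewrite /determinant.
apply: le_trans (ler_norm_sum _ _ _) _.
have -> : d`!%:R * \prod_i h i = \sum_(s : 'S_d) \prod_i h i.
  by rewrite sumr_const card_Sn mulr_natl.
apply: ler_sum => s _; rewrite normrM normrX normrN1 expr1n mul1r normr_prod.
by apply: ler_prod => i _; rewrite normr_ge0 Mh.
Qed.

(** Multiplying [M *m u] by the adjugate isolates [\det M * u a 0]. The cofactor of row i misses the
    factor [h i], and the bound [t * h i] on the right-hand side restores it, so all rows contribute
    the same product. *)
Lemma cramer_le (d : nat) (M : 'M[R]_d.+1) (u : 'cV[R]_d.+1) (a : 'I_d.+1)
    (h : 'I_d.+1 -> R) (t : R) :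
  1 <= `|\det M| -> (forall i j, `|M i j| <= h i) ->
  (forall i, `|(M *m u) i 0| <= t * h i) ->
  `|u a 0| <= d.+1`!%:R * t * \prod_i h i.
Proof.
move=> M1 Mh Mu.
have h0 i : 0 <= h i by apply: le_trans (Mh i a).
have e : \det M * u a 0 = \sum_i cofactor M i a * (M *m u) i 0.
  have := congr1 (fun N => (N *m u) a 0) (mul_adj_mx M).
  rewrite /= mul_scalar_mx -mulmxA [X in _ = X]mxE => <-.
  by rewrite mxE; apply: eq_bigr => i _; rewrite mxE.
apply: (@le_trans _ _ `|\det M * u a 0|).
  by rewrite normrM ler_peMl.
rewrite e; apply: le_trans (ler_norm_sum _ _ _) _.
have -> : d.+1`!%:R * t * \prod_i h i =
          \sum_(i < d.+1) (d`!%:R * (t * \prod_i h i)) :> R.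
  by rewrite sumr_const card_ord factS natrM -mulr_natl; ring.
apply: ler_sum => i _; rewrite normrM.
rewrite (bigD1_ord i) //=; set p := \prod_(_ < _) _.
have -> : d`!%:R * (t * (h i * p)) = (d`!%:R * p) * (t * h i) by ring.
apply: ler_pM => //.
rewrite /cofactor normrM normrX normrN1 expr1n mul1r.
by apply: normr_det_le => k l; rewrite !mxE.
Qed.

End Determinants.

Lemma sum_enum_val (I : finType) (V : nmodType) (E : I -> V) :
  \sum_i E i = \sum_(k < #|I|) E (enum_val k).
Proof. by rewrite (reindex _ (onW_bij _ (enum_val_bij I))). Qed.

(** * Heights of integer polynomials *)

Section Height.
Implicit Types P Q : {poly int}.

Lemma absz_coef_le P i : (absz (P`_i)%R <= height P)%N.
Proof.
rewrite /height; case: (ltnP i (size P)) => [lt_i|le_i].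
  exact: (leq_bigmax (Ordinal lt_i)).
by rewrite nth_default.
Qed.

Lemma height_leP P (m : nat) :
  (forall i, (absz (P`_i)%R <= m)%N) -> (height P <= m)%N.
Proof. by move=> Pm; apply/bigmax_leqP => i _. Qed.

Lemma height_attained P : P != 0 -> exists i, absz (P`_i)%R = height P.
Proof.
move=> P0; have sP : (0 < #|'I_(size P)|)%N by rewrite card_ord size_poly_gt0.
have [i ei] := bigop.eq_bigmax (fun i : 'I_(size P) => absz (P`_i)%R) sP.
by exists i; rewrite /height ei.
Qed.

Lemma height_gt0 P : P != 0 -> (0 < height P)%N.
Proof.
move=> P0; apply: leq_trans (absz_coef_le P (size P).-1).
by rewrite absz_gt0 -/(lead_coef P) lead_coef_eq0.
Qed.

Lemma heightXn P i : (height ('X^i * P) <= height P)%N.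
Proof.
apply: height_leP => j; rewrite coefXnM; case: ifP => // _.
exact: absz_coef_le.
Qed.

Lemma heightZ (a : int) P : height (a *: P) = (absz a * height P)%N.
Proof.
have [->|P0] := eqVneq P 0; first by rewrite scaler0 /height size_poly0 big_ord0 muln0.
apply/eqP; rewrite eqn_leq; apply/andP; split.
  by apply: height_leP => i; rewrite coefZ abszM leq_mul2l absz_coef_le orbT.
have [i <-] := height_attained P0.
by rewrite -abszM -coefZ absz_coef_le.
Qed.

Lemma normr_coef_le (R : realDomainType) P i :
  `|(P`_i)%:~R : R| <= (height P)%:R.
Proof.
by rewrite -intr_norm -abszE ler_nat absz_coef_le.
Qed.

End Height.

(** * Evaluation at [xi] and inequalities from free families *)

Definition int_free (I : finType) (F : I -> {poly int}) :=
  forall c : I -> int, \sum_i c i *: F i = 0 -> forall i, c i = 0.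

Section FreeFamilies.
Variables (R : realType) (xi : R).
Implicit Types P Q : {poly int}.

Definition value (P : {poly int}) : R := (map_poly intr P).[xi].

Lemma valueD P Q : value (P + Q) = value P + value Q.
Proof. by rewrite /value rmorphD hornerD. Qed.

Lemma valueB P Q : value (P - Q) = value P - value Q.
Proof. by rewrite /value rmorphB hornerD hornerN. Qed.

Lemma valueM P Q : value (P * Q) = value P * value Q.
Proof. by rewrite /value rmorphM hornerM. Qed.

Lemma valueZ a P : value (a *: P) = a%:~R * value P.
Proof. by rewrite /value map_polyZ hornerZ. Qed.

Lemma valueXn i : value 'X^i = xi ^+ i.
Proof. by rewrite /value map_polyXn hornerXn. Qed.

Lemma value_wide P m : (size P <= m)%N ->
  value P = \sum_(j < m) (P`_j)%:~R * xi ^+ j.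
Proof.
move=> sP; rewrite /value (horner_coef_wide _ (n := m)); last first.
  by rewrite (leq_trans (size_poly _ _)).
by apply: eq_bigr => j _; rewrite coef_map.
Qed.

Lemma value_neq0 P : transcendental xi -> P != 0 -> value P != 0.
Proof.
move=> tr P0; apply/negP => /eqP e; apply: tr.
exists (map_poly intr P); first by rewrite map_poly_eq0_id0 // intr_eq0 lead_coef_eq0.
rewrite -map_poly_comp (eq_map_poly (g := intr)) => [|a /=].
  by rewrite /root -/(value P) e.
by rewrite ratr_int.
Qed.

Lemma free_det_neq0 d (F : 'I_d -> {poly int}) :
  (forall i, (size (F i) <= d)%N) -> int_free F ->
  \det (\matrix_(i < d, j < d) (F i)`_j) != 0.
Proof.
move=> sF fF; apply/det0P => -[v v0 vM]; case/negP: v0; apply/eqP/rowP => i.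
rewrite mxE; apply: (fF (fun i => v 0 i)); apply/polyP => j.
rewrite coef0 coef_sum; case: (ltnP j d) => [ltj|lej].
  have /rowP/(_ (Ordinal ltj)) := vM; rewrite !mxE => e.
  by rewrite -[RHS]e; apply: eq_bigr => k _; rewrite mxE coefZ.
by rewrite big1 // => k _; rewrite coefZ nth_default ?mulr0 // (leq_trans (sF k)).
Qed.

Lemma ge1_normr_intr (a : int) : a != 0 -> 1 <= `|a%:~R : R|.
Proof. by move=> a0; rewrite -intr_norm -abszE -[X in X <= _]/(1%:R) ler_nat absz_gt0. Qed.

(** The coefficient matrix has a nonzero integer determinant, hence one of absolute value at least
    1, and it sends the vector of powers of [xi] to the values. Cramer's rule is applied to entry 0
    of that vector, which is 1. *)
Lemma free_value_le (I : finType) (F : I -> {poly int}) (h : I -> R) (t : R) :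
  (0 < #|I|)%N -> (forall i, (size (F i) <= #|I|)%N) -> int_free F ->
  (forall i, (height (F i))%:R <= h i) ->
  (forall i, `|value (F i)| <= t * h i) ->
  1 <= (#|I|)`!%:R * t * \prod_i h i.
Proof.
move=> I0 sF fF hF vF.
rewrite (reindex _ (onW_bij _ (enum_val_bij I))) /=.
have fF' : int_free (fun k : 'I_#|I| => F (enum_val k)).
  move=> c cF k; have := fF (fun i => c (enum_rank i)).
  rewrite sum_enum_val.
  under eq_bigr do rewrite enum_valK.
  by move=> /(_ cF (enum_val k)); rewrite enum_valK.
move: {fF} enum_val fF' => e; move: #|I| I0 sF e => [//|d] _ sF e fF.
have := @cramer_le R d
  (map_mx intr (\matrix_(i < d.+1, j < d.+1) (F (e i))`_j))
  (\col_j xi ^+ j) ord0 (fun k => h (e k)) t.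
rewrite mxE expr0 normr1; apply.
- rewrite det_map_mx ge1_normr_intr //.
  by apply: (free_det_neq0 (F := fun k => F (e k))).
- by move=> i j; rewrite !mxE; apply: le_trans (hF _); apply: normr_coef_le.
- move=> i; apply: le_trans (vF (e i)).
  rewrite (value_wide (sF _)) !mxE le_eqVlt; apply/orP; left; apply/eqP.
  by congr (`|_|); apply: eq_bigr => j _; rewrite !mxE.
Qed.
End FreeFamilies.

(** * Shifts of coprime polynomials *)

Section Coprime.
Implicit Types P Q T a b : {poly int}.

(** By Gauss's lemma [P] divides [b], which is too small to be a nonzero multiple. *)
Lemma coprime_rel_eq0 P Q a b :
  coprimep P Q -> (size b < size P)%N -> a * P + b * Q = 0 -> a = 0 /\ b = 0.
Proof.
move=> cPQ sb e.
have P0 : P != 0 by rewrite -size_poly_gt0 (leq_ltn_trans _ sb).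
have b0 : b = 0.
  apply/eqP/negPn/negP => b0.
  suff /(dvdp_leq b0) : P %| b by rewrite leqNgt sb.
  rewrite -(Gauss_dvdpl _ cPQ).
  have -> : b * Q = (- a) * P by rewrite mulNr; apply/eqP; rewrite -addr_eq0 addrC e.
  exact: dvdp_mulIr.
split=> //; apply/eqP; move/eqP: e; rewrite b0 mul0r addr0 mulf_eq0.
by rewrite (negbTE P0) orbF.
Qed.

Definition polyn_of (p : nat) (c : 'I_p -> int) : {poly int} :=
  \sum_(i < p) c i *: 'X^i.

Lemma coef_polyn_of p (c : 'I_p -> int) (i : 'I_p) : (polyn_of c)`_i = c i.
Proof.
rewrite coef_sum (bigD1 i) //= coefZ coefXn eqxx mulr1 big1 ?addr0 // => j ji.
by rewrite coefZ coefXn eq_sym (inj_eq val_inj) (negbTE ji) mulr0.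
Qed.

Lemma size_polyn_of p (c : 'I_p -> int) : (size (polyn_of c) <= p)%N.
Proof.
apply: (leq_trans (size_sum _ _ _)); apply/bigmax_leqP => i _.
by apply: (leq_trans (size_scale_leq _ _)); rewrite size_polyXn.
Qed.

Lemma polyn_of_mul p (c : 'I_p -> int) P :
  \sum_(i < p) c i *: ('X^i * P) = polyn_of c * P.
Proof. by rewrite mulr_suml; apply: eq_bigr => i _; rewrite scalerAl. Qed.

Lemma polyn_of_eq0 p (c : 'I_p -> int) : polyn_of c = 0 -> forall i, c i = 0.
Proof. by move=> c0 i; rewrite -coef_polyn_of c0 coef0. Qed.

(** For the right [p] and [q] these are the rows of the Sylvester matrix; the sum type keeps the two
    blocks apart in big sums and products. *)
Definition shifts (p q : nat) P Q (i : 'I_p + 'I_q) : {poly int} :=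
  match i with inl i => 'X^i * P | inr i => 'X^i * Q end.

Lemma free_shifts p q P Q : coprimep P Q -> (q < size P)%N ->
  int_free (@shifts p q P Q).
Proof.
move=> cPQ sP c; rewrite big_sumType /= !polyn_of_mul => e.
have [] := coprime_rel_eq0 cPQ (leq_ltn_trans (size_polyn_of _) sP) e.
by move=> /polyn_of_eq0 cl /polyn_of_eq0 cr [] i; [apply: cl | apply: cr].
Qed.

Definition int_free3 P Q T := forall a b c : int,
  a *: P + b *: Q + c *: T = 0 -> [/\ a = 0, b = 0 & c = 0].

Definition shifts_with (p m : nat) P Q T (i : ('I_p + 'I_p) + 'I_1) :=
  match i with inl i => @shifts p p P Q i | inr _ => 'X^m * T end.

Lemma free_shifts_with p P Q T : (0 < p)%N ->
  coprimep P Q -> size P = p.+2 -> int_free3 P Q T ->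
  exists2 m, (m < p)%N & int_free (@shifts_with p m P Q T).
Proof.
move=> p0 cPQ sP fPQT.
(* The shifts of [P] and [Q] alone are free, so only the coefficient of the shift of [T] needs to be
   shown zero. *)
have fm m : (forall a b (c : int), (size a <= p)%N -> (size b <= p)%N ->
    a * P + b * Q + c *: ('X^m * T) = 0 -> c = 0) ->
    int_free (@shifts_with p m P Q T).
  move=> Hm c; rewrite big_sumType big_ord1 /= => e.
  have c0 : c (inr ord0) = 0.
    move: e; rewrite big_sumType /= !polyn_of_mul.
    by apply: Hm; apply: size_polyn_of.
  move: e; rewrite c0 scale0r addr0 => e [i|i].
    by apply: (free_shifts cPQ _ e); rewrite sP.
  by rewrite ord1.
have [H0|] := pselect (forall a b (c : int), (size a <= p)%N -> (size b <= p)%N ->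
    a * P + b * Q + c *: T = 0 -> c = 0).
  by exists 0%N => //; apply: fm => a b c; rewrite mul1r; apply: H0.
(* T is a combination of P and Q with cofactors of size s = max (size a) (size b);
   shifting by p.+1 - s pushes a cofactor out of the admissible range, and
   cofactors of size at most p.+1 are unique up to scaling. *)
move=> /existsNP[a] /existsNP[b] /existsNP[c] /not_implyP[sa] /not_implyP[sb].
move=> /not_implyP[e /eqP c0].
pose s := maxn (size a) (size b).
have s1 : (1 < s)%N.
  rewrite ltnNge geq_max; apply/negP => /andP[/size1_polyC ea /size1_polyC eb].
  move: e; rewrite ea eb !mul_polyC => /fPQT[_ _ cc].
  by rewrite cc eqxx in c0.
have sp : (s <= p)%N by rewrite geq_max sa sb.
exists (p.+1 - s)%N; first by lia.
set m := (p.+1 - s)%N.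
apply: fm => a' b' c' sa' sb' e'; apply/eqP/negPn/negP => c'0.
have sXm (d : {poly int}) : d != 0 -> size (c' *: ('X^m * d)) = (m + size d)%N.
  by move=> d0; rewrite size_scale // size_monicM ?monicXn // size_polyXn.
have sXm' (d : {poly int}) : (size d <= s)%N -> (size (c' *: ('X^m * d)) <= p.+1)%N.
  have [->|d0] := eqVneq d 0; first by rewrite mulr0 scaler0 size_poly0.
  by move=> ds; rewrite sXm //; lia.
have rel : (c *: a' - c' *: ('X^m * a)) * P + (c *: b' - c' *: ('X^m * b)) * Q = 0.
  have -> : (c *: a' - c' *: ('X^m * a)) * P + (c *: b' - c' *: ('X^m * b)) * Q =
    c *: (a' * P + b' * Q + c' *: ('X^m * T))
    - c' *: ('X^m * (a * P + b * Q + c *: T)).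
    by rewrite -!mul_polyC; ring.
  by rewrite e e' mulr0 !scaler0 subrr.
have [|ra rb] := coprime_rel_eq0 cPQ _ rel.
  rewrite sP ltnS; apply: leq_trans (size_polyD _ _) _.
  rewrite size_polyN geq_max sXm' ?leq_maxr // andbT.
  by apply: (leq_trans (size_scale_leq _ _)); lia.
(* By [ra] and [rb], the larger of the two cofactors forces size m + s = p + 1 on [a'] or [b'],
   beyond the admissible p. *)
have [mx|mx] := leqP (size a) (size b).
  have b0 : b != 0 by rewrite -size_poly_gt0; lia.
  have eb : size b' = (m + size b)%N by rewrite -(sXm _ b0) -(subr0_eq rb) size_scale.
  by lia.
have a0 : a != 0 by rewrite -size_poly_gt0; lia.
have ea : size a' = (m + size a)%N by rewrite -(sXm _ a0) -(subr0_eq ra) size_scale.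
by lia.
Qed.

End Coprime.

(** * Resultant and triple inequalities at [xi] *)

Section ShiftBounds.
Variables (R : realType) (xi : R).
Implicit Types P Q T : {poly int}.

Lemma normr_exp_le m i : (i <= m)%N -> `|xi| ^+ i <= (1 + `|xi|) ^+ m.
Proof.
move=> im; apply: (@le_trans _ _ ((1 + `|xi|) ^+ i)).
  by apply: lerXn2r; rewrite ?nnegrE ?addr_ge0 ?lerDr.
by apply: ler_weXn2l; rewrite // lerDl.
Qed.

Lemma value_shift_le m i P t h : (i <= m)%N -> `|value xi P| <= t * h ->
  `|value xi ('X^i * P)| <= ((1 + `|xi|) ^+ m * t) * h.
Proof.
move=> im vP; rewrite valueM valueXn normrM normrX -mulrA.
by apply: ler_pM => //; apply: normr_exp_le.
Qed.

Lemma height_shift_le i P (h : R) : (height P)%:R <= h -> (height ('X^i * P))%:R <= h.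
Proof. by apply: le_trans; rewrite ler_nat heightXn. Qed.

Lemma size_shift_le i P s : (size P <= s)%N -> (size ('X^i * P)%R <= i + s)%N.
Proof.
move=> sP; have [->|P0] := eqVneq P 0; first by rewrite mulr0 size_poly0.
by rewrite size_monicM ?monicXn // size_polyXn; lia.
Qed.

(** The determinant of the [q] shifts of [P] and the [p] shifts of [Q] is, up to sign, a resultant.
    Multiplication by a power of X leaves heights alone and costs at most a power of [1 + |xi|] in
    the values. *)
Lemma resultant_le p q P Q (hP hQ t : R) : (0 < p + q)%N ->
  coprimep P Q -> size P = p.+1 -> (size Q <= q.+1)%N ->
  (height P)%:R <= hP -> (height Q)%:R <= hQ ->
  `|value xi P| <= t * hP -> `|value xi Q| <= t * hQ ->
  1 <= (p + q)`!%:R * ((1 + `|xi|) ^+ (p + q) * t) * (hP ^+ q * hQ ^+ p).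
Proof.
move=> pq0 cPQ sP sQ hhP hhQ vP vQ.
have := @free_value_le R xi ('I_q + 'I_p)%type (@shifts q p P Q)
  (fun i => match i with inl _ => hP | inr _ => hQ end)
  ((1 + `|xi|) ^+ (p + q) * t).
rewrite card_sum !card_ord addnC big_sumType /= !prodr_const !card_ord.
apply=> //.
- case=> i /=; have := ltn_ord i => iq; apply: leq_trans (size_shift_le _ (leqnn _)) _.
    by rewrite sP; lia.
  by lia.
- by apply: free_shifts => //; rewrite sP.
- by case=> i; apply: height_shift_le.
- by case=> i; apply: value_shift_le => //; have := ltn_ord i; lia.
Qed.

(** The family has 2 p + 1 members of degree at most 2 p, so its determinant is square; [T] enters
    through one row only, hence with exponent 1. *)
Lemma triple_le p P Q T (hP hQ hT t : R) : (0 < p)%N ->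
  coprimep P Q -> size P = p.+2 -> (size Q <= p.+2)%N -> (size T <= p.+2)%N ->
  int_free3 P Q T ->
  (height P)%:R <= hP -> (height Q)%:R <= hQ -> (height T)%:R <= hT ->
  `|value xi P| <= t * hP -> `|value xi Q| <= t * hQ -> `|value xi T| <= t * hT ->
  1 <= (p + p + 1)`!%:R * ((1 + `|xi|) ^+ (p + p + 1) * t) *
       (hP ^+ p * hQ ^+ p * hT).
Proof.
move=> p0 cPQ sP sQ sT fPQT hhP hhQ hhT vP vQ vT.
have [m mp fm] := free_shifts_with p0 cPQ sP fPQT.
have := @free_value_le R xi (('I_p + 'I_p) + 'I_1)%type (@shifts_with p m P Q T)
  (fun i => match i with inl (inl _) => hP | inl (inr _) => hQ | inr _ => hT end)
  ((1 + `|xi|) ^+ (p + p + 1) * t).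
rewrite !card_sum !card_ord !big_sumType /= big_ord1 !prodr_const !card_ord.
apply=> //; first by lia.
- case=> [[]|] i /=; have := ltn_ord i => iq; apply: leq_trans (size_shift_le _ (leqnn _)) _; lia.
- by case=> [[]|] i; apply: height_shift_le.
- by case=> [[]|] i; apply: value_shift_le => //; have := ltn_ord i; lia.
Qed.

End ShiftBounds.

(** * Gelfond's inequality for the height of a product *)

Section Gelfond.
Implicit Types A B C : {poly int}.

Lemma height0 : height 0 = 0%N.
Proof. by rewrite /height size_poly0 big_ord0. Qed.

Lemma PoszX (m k : nat) : (m ^ k)%N%:Z = m%:Z ^+ k.
Proof. by rewrite -!natz natrX. Qed.

Lemma leq_expnr (m m' k : nat) : (m <= m')%N -> (m ^ k <= m' ^ k)%N.
Proof. by case: k => // k mm'; rewrite leq_exp2r. Qed.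

Definition interp_cst (n : nat) : nat := ((n.+1)`! * ((n.*2.+1) ^ n) ^ n.+1)%N.

(** Interpolation: coefficients are recovered from n + 1 values by Cramer's rule for a Vandermonde
    matrix, whose determinant is a nonzero integer and whose entries are at most (2 n + 1)^n. The
    node returned is one where the value is largest. *)
Lemma interpolation_height_le n (f : 'I_n.+1 -> 'I_n.*2.+1) A :
  injective f -> (size A <= n.+1)%N ->
  exists i, (height A <= interp_cst n * absz (A.[(f i)%:Z])%R)%N.
Proof.
move=> f_inj sA; have [->|A0] := eqVneq A 0; first by exists ord0; rewrite height0.
have [k ek] := height_attained A0.
have kn : (k < n.+1)%N.
  rewrite ltnNge; apply/negP => nk; move: (height_gt0 A0).
  by rewrite -ek nth_default // (leq_trans sA).
pose y i := absz (A.[(f i)%:Z])%R.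
case: (@arg_maxnP _ ord0 predT y isT) => i _ ymax; exists i.
rewrite -ek -lez_nat abszE.
have -> : A`_k = (\col_(j < n.+1) A`_j) (Ordinal kn) 0 by rewrite mxE.
apply: le_trans (@cramer_le int n (\matrix_(i, j) ((f i)%:Z ^+ j)) (\col_j A`_j)
   (Ordinal kn) (fun=> ((n.*2.+1) ^ n)%N%:Z) (y i)%:Z _ _ _) _.
- rewrite -gtz0_ge1 normr_gt0.
  have -> : \matrix_(i, j) ((f i)%:Z ^+ j) =
            (Vandermonde n.+1 (\row_i (f i)%:Z))^T :> 'M[int]_n.+1.
    by apply/matrixP => a b; rewrite !mxE.
  rewrite det_tr det_Vandermonde; apply/prodf_neq0 => a _; apply/prodf_neq0 => b ab.
  rewrite !mxE subr_eq0 eqz_nat (inj_eq val_inj) (inj_eq f_inj).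
  by rewrite -(inj_eq val_inj) gtn_eqF.
- move=> a b; rewrite mxE normrX -abszE -PoszX lez_nat /=.
  apply: (@leq_trans ((n.*2.+1) ^ b)%N); first by rewrite leq_expnr // ltnW.
  by rewrite leq_pexp2l // -ltnS.
- move=> a; set z := (X in `|X|); have -> : z = A.[(f a)%:Z].
    by rewrite /z mxE (horner_coef_wide _ sA); apply: eq_bigr => j _; rewrite !mxE mulrC.
  rewrite -abszE -PoszM lez_nat; apply: leq_trans (ymax a isT) _.
  by rewrite leq_pmulr // expn_gt0.
- by rewrite prodr_const card_ord natz /interp_cst -PoszX -!PoszM lez_nat /y; lia.
Qed.

Lemma card_small_values_le n A : (size A <= n.+1)%N ->
  (#|[pred t : 'I_n.*2.+1 | (interp_cst n * absz (A.[t%:Z])%R < height A)%N]| <= n)%N.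
Proof.
move=> sA; rewrite leqNgt; apply/negP => lt_n.
pose f (i : 'I_n.+1) := enum_val (widen_ord lt_n i).
have f_inj : injective f by move=> i j /enum_val_inj /(congr1 val) /= /val_inj.
have [i] := interpolation_height_le f_inj sA.
by have := enum_valP (widen_ord lt_n i); rewrite inE ltnNge => /negP.
Qed.

Lemma horner_absz_le n C (t : 'I_n.*2.+1) : (size C <= n.*2.+1)%N ->
  (absz (C.[t%:Z])%R <= (n.*2.+1 * (n.*2.+1) ^ n.*2) * height C)%N.
Proof.
move=> sC; rewrite -lez_nat abszE (horner_coef_wide _ sC).
apply: le_trans (ler_norm_sum _ _ _) _.
apply: (@le_trans _ _ (\sum_(i < n.*2.+1) ((n.*2.+1) ^ n.*2 * height C)%N%:Z)).
  apply: ler_sum => i _; rewrite normrM normrX -!abszE -PoszX -PoszM lez_nat mulnC.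
  apply: leq_mul; last exact: absz_coef_le.
  apply: (@leq_trans ((n.*2.+1) ^ i)%N); first by rewrite leq_expnr //= ltnW.
  by rewrite leq_pexp2l // -ltnS.
by rewrite sumr_const card_ord -mulr_natl natz -PoszM mulnA.
Qed.

(* Each factor is small at no more than n of the 2 n + 1 points 0, ..., 2 n,
   so both are large at a common point. *)
Lemma height_mul_ge n : exists2 c : nat, (0 < c)%N &
  forall A B, (size A <= n.+1)%N -> (size B <= n.+1)%N ->
  (height A * height B <= c * height (A * B)%R)%N.
Proof.
exists ((interp_cst n * interp_cst n) * (n.*2.+1 * (n.*2.+1) ^ n.*2))%N.
  by rewrite !muln_gt0 !fact_gt0 !expn_gt0.
move=> A B sA sB.
pose bad (D : {poly int}) :=
  [pred t : 'I_n.*2.+1 | (interp_cst n * absz (D.[t%:Z])%R < height D)%N].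
have : (0 < #|[predC [predU bad A & bad B]]|)%N.
  have bA : (#|bad A| <= n)%N := card_small_values_le sA.
  have bB : (#|bad B| <= n)%N := card_small_values_le sB.
  rewrite lt0n; apply/eqP => C0.
  have := cardC [predU bad A & bad B]; rewrite C0 addn0 card_ord => U.
  have := leq_add bA bB; rewrite -cardUI U addnn leqNgt ltnS.
  by rewrite leq_addr.
case/card_gt0P => t; rewrite !inE negb_or -!leqNgt => /andP[tA tB].
apply: leq_trans (leq_mul tA tB) _.
rewrite mulnACA -abszM -hornerM -[X in (_ <= X)%N]mulnA leq_mul2l.
apply/orP; right.
apply: horner_absz_le; apply: leq_trans (size_polyMleq _ _) _; lia.
Qed.

End Gelfond.

(** * Finiteness of the polynomials of bounded degree and height *)

Section FiniteHeight.
Implicit Types P Q : {poly int}.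

Lemma finite_height (m B : nat) : exists s : seq {poly int},
  forall P : {poly int}, (size P <= m.+1)%N -> (height P <= B)%N -> P \in s.
Proof.
(* Coefficients between -B and B are encoded by ordinals below 2 B + 1 after adding B. *)
pose g (f : {ffun 'I_m.+1 -> 'I_B.*2.+1}) : {poly int} :=
  \poly_(i < m.+1) ((f (inord i))%:Z - B%:Z).
exists (codom g) => P sP hP; apply/codomP.
exists [ffun i : 'I_m.+1 => inord (absz (P`_i + B%:Z)%R)].
apply/polyP => i; rewrite coef_poly; case: ltnP => [im|mi].
  have := leq_trans (absz_coef_le P i) hP => Pi.
  by rewrite ffunE (inordK im) inordK; lia.
by rewrite nth_default // (leq_trans sP).
Qed.

Lemma seq_argmin (R : realDomainType) (T : eqType) (g : T -> R) (s : seq T) x0 :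
  x0 \in s -> exists2 x, x \in s & forall y, y \in s -> g x <= g y.
Proof.
elim: s x0 => // a s IHs x0 _; case: s IHs => [|b s] IHs.
  by exists a; rewrite ?mem_head // => y; rewrite inE => /eqP->.
have [x xs xmin] := IHs b (mem_head _ _).
have [ax|xa] := leP (g a) (g x).
  exists a; rewrite ?mem_head // => y; rewrite inE => /orP[/eqP->//|/xmin].
  exact: le_trans.
exists x; first by rewrite inE xs orbT.
by move=> y; rewrite inE => /orP[/eqP->|/xmin//]; apply: ltW.
Qed.

Lemma min_value (R : realType) (xi : R) m B (E : {poly int} -> Prop) P0 :
  E P0 -> (size P0 <= m.+1)%N -> (height P0 <= B)%N ->
  exists P, [/\ E P, (size P <= m.+1)%N, (height P <= B)%N &
    forall Q, E Q -> (size Q <= m.+1)%N -> (height Q <= B)%N ->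
      `|value xi P| <= `|value xi Q|].
Proof.
move=> E0 s0 h0; have [s sP] := finite_height m B.
pose ok P := [&& `[< E P >], (size P <= m.+1)%N & (height P <= B)%N].
have okP P : E P -> (size P <= m.+1)%N -> (height P <= B)%N ->
    P \in [seq P <- s | ok P].
  by move=> EP zP hP; rewrite mem_filter sP // andbT; apply/and3P; split=> //; apply/asboolP.
have [P] := seq_argmin (fun P => `|value xi P|) (okP _ E0 s0 h0).
rewrite mem_filter => /andP[/and3P[/asboolP EP zP hP] _] Pmin.
by exists P; split=> // Q EQ zQ hQ; apply/Pmin/okP.
Qed.

Lemma value_bounded_height_ge (R : realType) (xi : R) m B : transcendental xi ->
  exists2 c : R, 0 < c & forall Q, Q != 0 -> (size Q <= m.+1)%N ->
    (height Q <= B)%N -> c <= `|value xi Q|.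
Proof.
(* The bound B + 1 in place of B makes the constant 1 a competitor even when B = 0. *)
move=> tr; have h1 : (height 1 <= B.+1)%N.
  by apply: height_leP => i; rewrite coef1; case: (i == 0%N).
have s1 : (size (1%R : {poly int}) <= m.+1)%N by rewrite size_poly1.
have [P [P0 _ _ Pmin]] := @min_value R xi m B.+1 (fun Q => Q != 0) 1 (oner_neq0 _) s1 h1.
exists `|value xi P|; first by rewrite normr_gt0 value_neq0.
by move=> Q Q0 sQ hQ; apply: Pmin => //; apply: leqW.
Qed.

End FiniteHeight.

(** * Rational subspaces and determinants inside them *)

Section Subspace.
Implicit Types P Q : {poly int}.

(** This is membership in the rational span of [G], with the denominator [c] cleared so that all
    coefficients stay integral. *)
Definition in_span (I : finType) (G : I -> {poly int}) P :=
  exists c : int, exists2 e : I -> int, c != 0 & c *: P = \sum_j e j *: G j.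

Lemma in_span0 (I : finType) (G : I -> {poly int}) : in_span G 0.
Proof.
exists 1, (fun=> 0) => //; rewrite scaler0 big1 // => j _; exact: scale0r.
Qed.

Lemma in_spanD (I : finType) (G : I -> {poly int}) P Q :
  in_span G P -> in_span G Q -> in_span G (P + Q).
Proof.
move=> [c [e c0 eP]] [c' [e' c'0 eQ]].
exists (c * c'), (fun j => c' * e j + c * e' j); first by rewrite mulf_neq0.
under eq_bigr do rewrite scalerDl -!scalerA.
rewrite big_split -!scaler_sumr -eP -eQ.
by rewrite scalerDr !scalerA (mulrC c').
Qed.

Lemma in_spanZ (I : finType) (G : I -> {poly int}) a P :
  in_span G P -> in_span G (a *: P).
Proof.
move=> [c [e c0 eP]]; exists c, (fun j => a * e j) => //.
under eq_bigr do rewrite -scalerA.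
by rewrite -scaler_sumr -eP !scalerA mulrC.
Qed.

Lemma in_span_gen (I : finType) (G : I -> {poly int}) i : in_span G (G i).
Proof.
exists 1, (fun j => (i == j)%:R) => //; rewrite scale1r (bigD1 i) //= eqxx scale1r.
by rewrite big1 ?addr0 // => j; rewrite eq_sym => /negbTE->; rewrite scale0r.
Qed.

Variable N : nat.

Definition dotp P Q : int := \sum_(k < N) P`_k * Q`_k.

Lemma dotpC P Q : dotp P Q = dotp Q P.
Proof. by apply: eq_bigr => k _; rewrite mulrC. Qed.

Lemma dotp_suml (I : finType) (c : I -> int) (F : I -> {poly int}) Q :
  dotp (\sum_i c i *: F i) Q = \sum_i c i * dotp (F i) Q.
Proof.
rewrite /dotp; under [RHS]eq_bigr do rewrite mulr_sumr.
rewrite exchange_big; apply: eq_bigr => k _; rewrite coef_sum mulr_suml.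
by apply: eq_bigr => i _; rewrite coefZ mulrA.
Qed.

Lemma dotpZl a P Q : dotp (a *: P) Q = a * dotp P Q.
Proof. by rewrite /dotp mulr_sumr; apply: eq_bigr => k _; rewrite coefZ mulrA. Qed.

Lemma dotp_eq0 P : (size P <= N)%N -> dotp P P = 0 -> P = 0.
Proof.
move=> sP /eqP; rewrite psumr_eq0; last by move=> k _; rewrite -expr2 sqr_ge0.
move=> /allP P0; apply/polyP => k; rewrite coef0.
case: (ltnP k N) => [kN|Nk]; last by rewrite nth_default // (leq_trans sP).
by have /= := P0 (Ordinal kN) (mem_index_enum _); rewrite mulf_eq0 orbb => /eqP.
Qed.

(* The Gram matrix against the fixed family G replaces a choice of d + 1
   coordinates in which the span of G has full rank. *)
Lemma subspace_value_le (R : realType) (xi : R) d (G : 'I_d.+1 -> {poly int}) :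
  transcendental xi -> (forall i, (size (G i) <= N)%N) -> int_free G ->
  exists2 C : R, 0 < C & forall (F : 'I_d.+1 -> {poly int}) (h : 'I_d.+1 -> R) (t : R),
    (forall i, (size (F i) <= N)%N) -> int_free F ->
    (forall i, in_span G (F i)) ->
    (forall i, (height (F i))%:R <= h i) ->
    (forall i, `|value xi (F i)| <= t * h i) ->
    1 <= C * t * \prod_i h i.
Proof.
move=> tr sG fG.
pose W : 'M[int]_d.+1 := \matrix_(i, j) dotp (G i) (G j).
have size_comb (c : 'I_d.+1 -> int) (F : 'I_d.+1 -> {poly int}) :
    (forall i, (size (F i) <= N)%N) -> (size (\sum_i c i *: F i)%R <= N)%N.
  move=> sF; apply: (leq_trans (size_sum _ _ _)); apply/bigmax_leqP => i _.
  exact: leq_trans (size_scale_leq _ _) (sF i).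
(* Positive definiteness of the dot product: a multiple of [P] is a combination of the [G j], so [P]
   is orthogonal to itself. *)
have span_orth P : (size P <= N)%N -> in_span G P ->
    (forall j, dotp P (G j) = 0) -> P = 0.
  move=> sP [c [e c0 eP]] PG.
  suff : c *: P = 0 by move/eqP; rewrite -mul_polyC mulf_eq0 polyC_eq0 (negbTE c0) => /eqP.
  apply: dotp_eq0; first exact: leq_trans (size_scale_leq _ _) sP.
  rewrite {1}eP dotp_suml big1 // => j _.
  by rewrite dotpC dotpZl PG !mulr0.
have det_neq0 (F : 'I_d.+1 -> {poly int}) : (forall i, (size (F i) <= N)%N) ->
    int_free F -> (forall i, in_span G (F i)) ->
    \det (\matrix_(i, j) dotp (F i) (G j)) != 0.
  move=> sF fF FG; apply/det0P => -[v v0 vM]; case/negP: v0; apply/eqP/rowP => i.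
  rewrite mxE; apply: (fF (fun i => v 0 i)); apply: span_orth.
  - exact: size_comb.
  - by apply: (big_ind (in_span G)) => [|P Q|k _];
      [exact: in_span0 | exact: in_spanD | exact: in_spanZ].
  - move=> j; have /rowP/(_ j) := vM; rewrite !mxE => e; rewrite -[RHS]e dotp_suml.
    by apply: eq_bigr => k _; rewrite mxE.
have W0 : \det W != 0 by apply: det_neq0 => // i; apply: in_span_gen.
pose g : 'cV[R]_d.+1 := \col_j value xi (G j).
(* The vector [u] represents evaluation on the span: the value of [P] there is the sum over j of
   [dotp P (G j)] times the j-th entry of [u]. *)
pose u := invmx (map_mx intr W) *m g.
have Wu : map_mx intr W *m u = g.
  by rewrite mulKVmx // unitmxE det_map_mx unitfE intr_eq0.
have [a ua] : exists a, u a 0 != 0.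
  apply: contrapT => u0.
  have uz : u = 0.
    apply/colP => a; rewrite [RHS]mxE; apply/eqP/negPn/negP => ua.
    by apply: u0; exists a.
  have /colP/(_ ord0) := Wu; rewrite uz mulmx0 !mxE => /esym/eqP.
  apply/negP/value_neq0 => //; apply/eqP => G0.
  have := fG (fun j => (j == ord0)%:R); rewrite (bigD1 ord0) //= G0 scaler0 add0r.
  by rewrite big1 => [/(_ erefl ord0)//|j /negbTE->]; rewrite scale0r.
(* [K] bounds the dot product with any [G j] by [K] times the height. *)
pose K : R := 1 + \sum_j \sum_(k < N) `|((G j)`_k)%:~R|.
have K1 : 1 <= K by rewrite lerDl !sumr_ge0 // => j _; rewrite sumr_ge0.
have K0 : 0 < K by apply: lt_le_trans K1.
exists (`|u a 0|^-1 * (d.+1`!%:R * K^-1 * K ^+ d.+1)).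
  by rewrite !mulr_gt0 ?invr_gt0 ?normr_gt0 ?exprn_gt0 // ltr0n fact_gt0.
move=> F h t sF fF FG hF vF.
have := @cramer_le R d (map_mx intr (\matrix_(i, j) dotp (F i) (G j))) u a
  (fun i => K * h i) (t * K^-1).
rewrite big_split /= prodr_const card_ord => H.
have {}H : `|u a 0| <= (d.+1)`!%:R * (t / K) * (K ^+ d.+1 * \prod_i h i).
  apply: H.
  - by rewrite det_map_mx ge1_normr_intr // det_neq0.
  - move=> i j; rewrite !mxE /dotp rmorph_sum.
    apply: le_trans (ler_norm_sum _ _ _) _.
    apply: (@le_trans _ _ (\sum_(k < N) `|((G j)`_k)%:~R| * h i)).
      apply: ler_sum => k _; rewrite rmorphM normrM mulrC ler_wpM2l //.
      by apply: le_trans (hF i); apply: normr_coef_le.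
    rewrite -mulr_suml ler_wpM2r //; first by apply: le_trans (hF i).
    rewrite /K (bigD1 j) //= addrCA lerDl addr_ge0 ?sumr_ge0 // => k _.
    by rewrite sumr_ge0.
  - move=> i; rewrite mulrA mulfVK ?gt_eqF //; apply: le_trans (vF i).
    rewrite le_eqVlt; apply/orP; left; apply/eqP; congr (`|_|).
    have [c [e c0 eF]] := FG i.
    have cR : (c%:~R : R) != 0 by rewrite intr_eq0.
    apply: (mulfI cR); rewrite -valueZ eF.
    have -> : value xi (\sum_j e j *: G j) = \sum_j (e j)%:~R * g j 0.
      rewrite /value rmorph_sum horner_sum; apply: eq_bigr => j _.
      by rewrite mxE -valueZ.
    rewrite -Wu mxE mulr_sumr.
    under [RHS]eq_bigr do rewrite mxE mulr_sumr.
    rewrite [RHS]exchange_big; apply: eq_bigr => j _; rewrite !mxE /= mulrA.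
    under [RHS]eq_bigr do rewrite !mxE mulrA.
    rewrite -mulr_suml -rmorphM -dotpZl eF dotp_suml rmorph_sum; congr (_ * _).
    by apply: eq_bigr => k _; rewrite rmorphM.
have ua0 : 0 < `|u a 0| by rewrite normr_gt0.
rewrite -(ler_pM2l ua0) mulr1.
apply: le_trans H _; rewrite le_eqVlt; apply/orP; left; apply/eqP.
by field; rewrite gt_eqF //= normr_eq0.
Qed.

End Subspace.

(** * Lower bounds for values of polynomials of low degree *)

Section LowDegree.
Variables (R : realType) (xi : R).
Implicit Types P Q A B G : {poly int}.

Lemma powR_neg_small (C delta : R) : 0 < delta ->
  exists2 X1 : R, 1 <= X1 & forall X, X1 <= X -> C * X `^ (- delta) < 1.
Proof.
move=> d0; pose D := `|C| + 1.
have D0 : 0 < D by rewrite ltr_wpDl.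
exists (1 + D `^ delta^-1); first by rewrite lerDl powR_ge0.
move=> X XX; have X0 : 0 < X by apply: lt_le_trans XX; rewrite ltr_pwDl // powR_ge0.
rewrite powRN -ltr_pdivlMr ?invr_gt0 ?powR_gt0 // invrK mul1r.
apply: (@lt_le_trans _ _ D); first by rewrite (le_lt_trans (ler_norm _)) // ltrDl.
have -> : D = (D `^ delta^-1) `^ delta by rewrite -powRrM mulVf ?gt_eqF // powRr1 // ltW.
apply: ge0_ler_powR; rewrite ?nnegrE ?powR_ge0 ?ltW //.
by apply: lt_le_trans XX; rewrite ltrDr.
Qed.

Lemma height_ge1 Q : Q != 0 -> 1 <= (height Q)%:R :> R.
Proof. by move=> Q0; rewrite ler1n height_gt0. Qed.

(** Divisibility in [{poly int}] holds only up to a constant multiple; by Gauss's lemma the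
    primitive part of [G] is a genuine integer factor. *)
Lemma proper_factor Q G : Q != 0 -> G %| Q -> (1 < size G < size Q)%N ->
  exists A B, [/\ Q = A * B, A != 0, B != 0, (size A < size Q)%N & (size B < size Q)%N].
Proof.
move=> Q0 /dvdpP_int[r eQ] /andP[G1 GQ]; exists (zprimitive G), r.
have : zprimitive G * r != 0 by rewrite -eQ.
rewrite mulf_eq0 negb_or => /andP[G0 r0]; split=> //; first by rewrite size_zprimitive.
have -> : size Q = (size G + size r).-1 by rewrite eQ size_mul // size_zprimitive.
by case: (size G) G1 => [|[|k]] //= _; rewrite !addSn /= ltnS leq_addl.
Qed.

(** Values are multiplicative and, by Gelfond's inequality, heights are so up to a constant; a lower
    bound with a fixed exponent therefore passes to products. *)
Lemma product_value_ge m e (c : R) : 0 < c ->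
  exists2 c' : R, 0 < c' & forall A B, A != 0 -> B != 0 ->
    (size A <= m.+1)%N -> (size B <= m.+1)%N ->
    c <= `|value xi A| * (height A)%:R ^+ e ->
    c <= `|value xi B| * (height B)%:R ^+ e ->
    c' <= `|value xi (A * B)| * (height (A * B))%:R ^+ e.
Proof.
move=> c0; have [g g0 Hg] := height_mul_ge m.
have gR : 0 < g%:R :> R by rewrite ltr0n.
exists (c * c / g%:R ^+ e); first by rewrite !mulr_gt0 // invr_gt0 exprn_gt0.
move=> A B A0 B0 sA sB cA cB.
rewrite ler_pdivrMr ?exprn_gt0 // valueM normrM.
apply: le_trans (ler_pM (ltW c0) (ltW c0) cA cB) _.
rewrite mulrACA -[X in _ <= X]mulrA ler_wpM2l ?mulr_ge0 // -!exprMn.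
apply: lerXn2r; rewrite ?nnegrE ?mulr_ge0 //.
by rewrite -!natrM ler_nat [X in (_ <= X)%N]mulnC Hg.
Qed.

Variables (p : nat) (x : R).
Hypothesis tr : transcendental xi.
Hypothesis px : (p + p)%:R < x.
Hypothesis approx : uniformly_approximable p.+1 xi x.

Lemma approximableP : exists2 X0 : R, 1 <= X0 & forall X, X0 <= X ->
  exists P, [/\ P != 0, (size P <= p.+2)%N, (height P)%:R <= X &
               `|value xi P| <= X `^ (- x)].
Proof.
case: approx => M [_ HM]; exists (Num.max M 0 + 1).
  by rewrite lerDr le_max lexx orbT.
move=> X MX; have MX' : M < X.
  by apply: lt_le_trans MX; rewrite ltr_pwDr // le_max lexx.
have [P [sP hP vP vPX]] := HM X MX'; exists P; split=> //.
by apply: contraTneq vP => ->; rewrite rmorph0 horner0 normr0 ltxx.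
Qed.

(** A primitive [Q] of height H is compared with the approximating [P] at X = H / k. If they share a
    proper factor of [Q], then [Q] splits and the smaller sizes suffice. If [Q] divides [P], the
    height of [P] is too large. Otherwise their resultant bounds the value of [Q] from below. *)
Lemma low_degree_step s (c : R) : (s <= p)%N -> 0 < c ->
  (forall Q, Q != 0 -> (size Q <= s)%N ->
    c <= `|value xi Q| * (height Q)%:R ^+ (p + p)) ->
  exists2 c' : R, 0 < c' & forall Q, Q != 0 -> (size Q <= s.+1)%N ->
    c' <= `|value xi Q| * (height Q)%:R ^+ (p + p).
Proof.
move=> sp c0 IH.
have [X0 X01 HX0] := approximableP.
have [g g0 Hg] := height_mul_ge p.+1.
(* With [g] the Gelfond constant, the factor 2 makes every nonzero multiple of [Q] of size at most p
   + 2 have height above H / k. *)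
pose k : R := (2 * g)%:R.
have k1 : 1 <= k by rewrite ler1n muln_gt0.
have k0 : 0 < k by apply: lt_le_trans k1.
pose C : R := (p + p.+1)`!%:R * (1 + `|xi|) ^+ (p + p.+1).
have C0 : 0 < C by rewrite mulr_gt0 ?ltr0n ?fact_gt0 // exprn_gt0 // ltr_pwDl.
have [X1 X11 HX1] := @powR_neg_small (C * k ^+ p.+1) (x - (p + p)%:R) (ltac:(by rewrite subr_gt0)).
(* Heights up to [B] are covered by finiteness; above [B], the parameter H / k exceeds both
   thresholds. *)
pose B := Num.bound (k * Num.max X0 X1).
have [cf cf0 Hcf] := @value_bounded_height_ge R xi s B tr.
have [cp cp0 Hcp] := @product_value_ge p (p + p) c c0.
exists (Num.min C^-1 (Num.min cf cp)); first by rewrite !lt_min invr_gt0 C0 cf0 cp0.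
(* Multiplication by the content decreases neither value nor height in absolute value, so the
   primitive part suffices. *)
suff prim Q : Q != 0 -> (size Q <= s.+1)%N -> zprimitive Q = Q ->
    Num.min C^-1 (Num.min cf cp) <= `|value xi Q| * (height Q)%:R ^+ (p + p).
  move=> Q Q0 sQ; have Z0 : zprimitive Q != 0 by rewrite zprimitive_eq0.
  apply: le_trans (prim _ Z0 _ (zprimitive_id Q)) _; first by rewrite size_zprimitive.
  have z0 : zcontents Q != 0 by rewrite zcontents_eq0.
  rewrite {3 4}[Q]zpolyEprim valueZ normrM heightZ.
  apply: ler_pM; rewrite ?exprn_ge0 //; first by rewrite ler_peMl // ge1_normr_intr.
  apply: lerXn2r; rewrite ?nnegrE // ler_nat leq_pmull // absz_gt0.
  done.
move=> Q0 sQ zQ; rewrite !ge_min.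
have H1 := height_ge1 Q0; set H : R := (height Q)%:R in H1 *.
have H0 : 0 < H by apply: lt_le_trans H1.
have [hB|hB] := leqP (height Q) B.
  apply/orP; right; apply/orP; left; apply: le_trans (Hcf _ Q0 sQ hB) _.
  by rewrite ler_peMr // exprn_ege1.
pose X := H / k.
have [XX0 XX1] : X0 <= X /\ X1 <= X.
  suff : Num.max X0 X1 <= X by rewrite ge_max => /andP.
  rewrite ler_pdivlMr // mulrC; apply: ltW.
  have m0 : 0 <= k * Num.max X0 X1.
    by rewrite mulr_ge0 ?(ltW k0) // le_max (le_trans ler01 X01).
  by apply: lt_le_trans (archi_boundP m0) _; rewrite ler_nat ltnW.
have X1' : 1 <= X by apply: le_trans XX1.
have X_gt0 : 0 < X by apply: lt_le_trans X1'.
have XH : X <= H by rewrite ler_pdivrMr // ler_peMr // ltW.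
have [P [P0 sP hP vP]] := HX0 _ XX0.
have GQ := dvdp_gcdl Q P; have GP := dvdp_gcdr Q P.
set G := gcdp Q P in GQ GP.
have G0 : (0 < size G)%N by rewrite size_poly_gt0 gcdp_eq0 negb_and Q0.
have GleQ := dvdp_leq Q0 GQ.
have [G1|G1] := eqVneq (size G) 1%N; last first.
  have [GQs|GQs] := eqVneq (size G) (size Q).
    have QP : Q %| P.
      by move/eqP: GQs; rewrite (dvdp_size_eqp GQ) => /eqp_dvdl <-.
    have [r eP] := dvdpP_int QP; rewrite zQ in eP.
    have r0 : r != 0 by apply: contraNneq P0 => r0; rewrite eP r0 mulr0.
    have sr : (size r <= p.+2)%N.
      apply: leq_trans sP; rewrite eP size_mul //.
      by move: Q0; rewrite -size_poly_gt0; case: (size Q) => //= q _; rewrite leq_addl.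
    have := Hg Q r (leq_trans sQ (leq_trans (sp : (s.+1 <= p.+1)%N) (leqnSn _))) sr.
    rewrite -eP -(ler_nat R) !natrM => H2.
    have : H <= g%:R * X.
      apply: (@le_trans _ _ (H * (height r)%:R)); first by rewrite ler_peMr ?(ltW H0) ?height_ge1.
      by apply: le_trans H2 _; rewrite ler_wpM2l.
    move=> HgX; suff : g%:R * X < H by rewrite ltNge HgX.
    have gR : 0 < g%:R :> R by rewrite ltr0n.
    have -> : g%:R * X = H / 2 by rewrite /X /k natrM; field; rewrite gt_eqF.
    by rewrite ltr_pdivrMr // ltr_pMr // ltr1n.
  have [|A [A' [eQ A0 A'0 sA sA']]] := @proper_factor Q G Q0 GQ.
    by apply/andP; split; rewrite ltn_neqAle; [rewrite eq_sym G1 | rewrite GQs].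
  have sA1 : (size A <= s)%N by rewrite -ltnS (leq_trans sA).
  have sA1' : (size A' <= s)%N by rewrite -ltnS (leq_trans sA').
  apply/orP; right; apply/orP; right; rewrite /H eQ; apply: Hcp => //; try exact: IH.
    by rewrite (leq_trans sA1) // leqW.
  by rewrite (leq_trans sA1') // leqW.
have cQP : coprimep Q P by rewrite /coprimep -/G G1.
apply/orP; left.
have [d sd] : exists d, size Q = d.+1.
  by move: Q0; rewrite -size_poly_gt0; case: (size Q) => // d _; exists d.
have dp : (d <= p)%N by rewrite -ltnS -sd (leq_trans sQ).
(* The degree [d] of [Q] is replaced by [p]; this only weakens the bound since [X >= 1]. *)
have res t : `|value xi Q| <= t * H -> `|value xi P| <= t * X ->
    1 <= C * t * (H ^+ p.+1 * X ^+ p).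
  move=> tQ tP.
  have t0 : 0 <= t by rewrite -(pmulr_lge0 _ H0) (le_trans _ tQ).
  apply: le_trans (@resultant_le R xi d p.+1 Q P H X t _ cQP sd sP _ hP tQ tP) _.
  - by rewrite addnS.
  - by [].
  rewrite mulrA; apply: ler_pM; rewrite ?mulr_ge0 ?exprn_ge0 ?addr_ge0 ?(ltW H0) ?(ltW X_gt0) //.
    rewrite ler_wpM2r //; apply: ler_pM; rewrite ?exprn_ge0 ?addr_ge0 //.
      rewrite ler_nat; move: dp; rewrite leq_eqVlt => /predU1P[->//|dp].
      by apply/ltnW/ltn_fact; [rewrite addnS | rewrite ltn_add2r].
    by apply: ler_weXn2l; rewrite ?lerDl // leq_add2r.
  by rewrite ler_wpM2l ?exprn_ge0 ?(ltW H0) // ler_weXn2l.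
(* The larger of the two ratios of value to height serves as [t]. If it belongs to [Q], the
   resultant gives the claim. *)
have [tle|tle] := leP (X `^ (- x) / X) (`|value xi Q| / H).
  have := res (`|value xi Q| / H); rewrite mulfVK ?gt_eqF // lexx => /(_ isT).
  have -> : `|value xi P| <= `|value xi Q| / H * X.
    by rewrite -ler_pdivrMr //; apply: le_trans tle; rewrite ler_pM2r ?invr_gt0.
  move=> /(_ isT) r1.
  rewrite -div1r ler_pdivrMr // [Y in _ <= Y]mulrC; apply: le_trans r1 _.
  have -> : C * (`|value xi Q| / H) * (H ^+ p.+1 * X ^+ p) =
            C * (`|value xi Q| * (H ^+ p * X ^+ p)).
    by rewrite exprS; field; rewrite gt_eqF.
  rewrite exprD ler_wpM2l ?(ltW C0) // ler_wpM2l //.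
  by rewrite ler_wpM2l ?exprn_ge0 ?(ltW H0) // lerXn2r // nnegrE ltW.
(* Here the ratio of [P] is the larger one and the resultant gives 1 <= C k^(p+1) X^(2p - x), which
   fails beyond [X1] because x > 2 p. *)
exfalso.
have := res (X `^ (- x) / X); rewrite mulfVK ?gt_eqF // vP.
have -> : `|value xi Q| <= X `^ (- x) / X * H by rewrite -ler_pdivrMr // ltW.
move=> /(_ isT isT); apply/negP; rewrite -ltNge.
apply: le_lt_trans (HX1 _ XX1).
have -> : H = k * X by rewrite /X mulrC mulfVK ?gt_eqF.
rewrite le_eqVlt; apply/orP; left; apply/eqP.
rewrite opprB addrC powRD; last by rewrite (gt_eqF X_gt0) implybT.
rewrite powR_mulrn ?ltW // exprMn exprD !exprS.
by field; rewrite gt_eqF.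
Qed.

(** Induction on the size from the vacuous size 0; the exponent stays 2 p throughout, so only the
    constant changes. *)
Lemma low_degree_value_ge : exists2 c : R, 0 < c & forall Q, Q != 0 ->
  (size Q <= p.+1)%N -> c <= `|value xi Q| * (height Q)%:R ^+ (p + p).
Proof.
have : (p.+1 <= p.+1)%N by [].
elim: {1 3}p.+1 => [|s IHs] sp.
  by exists 1 => // Q Q0; rewrite leqn0 size_poly_eq0 (negbTE Q0).
have [c c0 Hc] := IHs (ltnW sp).
exact: low_degree_step Hc.
Qed.

End LowDegree.

(** * Minimal polynomials and their logarithmic inequalities *)

Section MinimalSequence.
Variables (R : realType) (xi : R).
Implicit Types P Q A B : {poly int}.

Lemma ln_exprn (n : nat) (y : R) : 0 < y -> ln (y ^+ n) = n%:R * ln y.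
Proof. by move=> y0; rewrite lnXn // mulr_natl. Qed.

(** These are successive best approximations: by the last clause, [P k] has the smallest value among
    nonzero competitors of height below that of [P k.+1]. *)
Definition minimal_sequence (m : nat) (P : nat -> {poly int}) :=
  [/\ forall k, P k != 0 /\ (size (P k) <= m)%N,
      forall k, `|value xi (P k.+1)| < `|value xi (P k)|,
      forall k, (height (P k) < height (P k.+1))%N &
      forall k Q, Q != 0 -> (size Q <= m)%N ->
        `|value xi Q| < `|value xi (P k)| -> (height (P k.+1) <= height Q)%N].

(** The successor first minimises the height among the polynomials improving on [P], then the value
    within that height. The second choice makes the heights strictly increase. *)
Lemma exists_minimal_sequence m : transcendental xi ->
  (forall e : R, 0 < e ->
    exists Q, [/\ Q != 0, (size Q <= m.+1)%N & `|value xi Q| < e]) ->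
  exists P : nat -> {poly int}, minimal_sequence m.+1 P.
Proof.
move=> tr small.
pose E P Q := [/\ Q != 0, (size Q <= m.+1)%N & `|value xi Q| < `|value xi P|].
(* The premise sits inside [next] so that [choice] applies to all polynomials, zero included. *)
pose next P Q := P != 0 -> [/\ E P Q,
  forall Q', E P Q' -> (height Q <= height Q')%N &
  forall Q', Q' != 0 -> (size Q' <= m.+1)%N -> (height Q' <= height Q)%N ->
    `|value xi Q| <= `|value xi Q'|].
have /choice[f fP] : forall P, exists Q, next P Q.
  move=> P; have [->|P0] := eqVneq P 0; first by exists 0; rewrite /next eqxx.
  have [Q0 EQ0] : exists Q, E P Q by apply: small; rewrite normr_gt0 value_neq0.
  pose has_height b := `[< exists2 Q, E P Q & height Q = b >].
  have ex : exists b, has_height b by exists (height Q0); apply/asboolP; exists Q0.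
  case: (ex_minnP ex) => b /asboolP[Q1 EQ1 hQ1] bmin.
  have bminE Q : E P Q -> (b <= height Q)%N.
    by move=> EQ; apply: bmin; apply/asboolP; exists Q.
  have [|||Q [EQ sQ hQ Qmin]] := @min_value R xi m b (E P) Q1 => //.
  - by case: EQ1.
  - by rewrite hQ1.
  exists Q => _; split=> // [Q' /bminE|Q' Q'0 sQ' hQ']; first exact: leq_trans.
  rewrite leNgt; apply/negP => lt.
  have EQ' : E P Q' by split=> //; case: EQ => _ _; apply: lt_trans.
  by move: lt; rewrite ltNge Qmin // (leq_trans hQ').
(* The seed 1 is dropped because it is not known to minimise the value for its height. *)
exists (fun k => iter k.+1 f 1).
have f0 k : iter k f 1 != 0.
  by elim: k => [|k IHk]; rewrite ?oner_neq0 //= ; have [[]] := fP _ IHk.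
split=> k.
- by have [[]] := fP _ (f0 k).
- by have [[]] := fP _ (f0 k.+1).
- have [_ _ Hmin] := fP _ (f0 k); have [[n0 s lt] _ _] := fP _ (f0 k.+1).
  rewrite ltnNge; apply/negP => le; move: lt; rewrite ltNge /= Hmin //.
- by move=> Q Q0 sQ vQ; have [_ + _] := fP _ (f0 k.+1); apply; split.
Qed.

Variables (p : nat) (x : R).
Hypotheses (tr : transcendental xi) (p0 : (0 < p)%N).
Hypothesis px : (p + p)%:R < x.
Hypothesis approx : uniformly_approximable p.+1 xi x.

Lemma x_gt1 : 1 < x.
Proof. by apply: le_lt_trans px; rewrite ler1n addn_gt0 p0. Qed.

Lemma x_gt0 : 0 < x.
Proof. exact: lt_trans ltr01 x_gt1. Qed.

Lemma exists_minimal_sequence_uniform : exists P : nat -> {poly int}, minimal_sequence p.+2 P.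
Proof.
apply: exists_minimal_sequence => // e e0.
have [X0 X01 HX0] := approximableP approx.
have [X1 X11 HX1] := @powR_neg_small R e^-1 x x_gt0.
have [|P [P0 sP _ vP]] := HX0 (Num.max X0 X1); first by rewrite le_max lexx.
exists P; split=> //; apply: le_lt_trans vP _.
have : e^-1 * Num.max X0 X1 `^ (- x) < 1 by apply: HX1; rewrite le_max lexx orbT.
by rewrite mulrC ltr_pdivrMr // mul1r.
Qed.

Variable P : nat -> {poly int}.
Hypothesis minP : minimal_sequence p.+2 P.

Let h k : R := ln (height (P k))%:R.
Let l k : R := - ln `|value xi (P k)|.

Let P_neq0 k : P k != 0. Proof. by case: minP => /(_ k)[]. Qed.
Let P_size k : (size (P k) <= p.+2)%N. Proof. by case: minP => /(_ k)[]. Qed.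

Let value_gt0 k : 0 < `|value xi (P k)|.
Proof. by rewrite normr_gt0 value_neq0. Qed.

Let heightR_gt0 k : 0 < (height (P k))%:R :> R.
Proof. by rewrite ltr0n height_gt0. Qed.

Lemma log_height_lt k : h k < h k.+1.
Proof. by case: minP => _ _ hP _; rewrite ltr_ln ?posrE // ltr_nat. Qed.

Lemma height_homo i j : (i <= j)%N -> (height (P i) <= height (P j))%N.
Proof.
move=> /subnK <-; elim: (j - i)%N => // k IHk; apply: leq_trans IHk _.
by case: minP => _ _ hP _; apply: ltnW.
Qed.

Lemma value_homo i j : (i <= j)%N -> `|value xi (P j)| <= `|value xi (P i)|.
Proof.
move=> /subnK <-; elim: (j - i)%N => // k IHk; apply: le_trans IHk.
by case: minP => _ vP _ _; exact: ltW (vP (k + i)%N).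
Qed.

Lemma height_ge_index k : (k <= height (P k))%N.
Proof.
by elim: k => // k IHk; case: minP => _ _ hP _; apply: leq_ltn_trans (hP k).
Qed.

Lemma log_height_unbounded (M : R) : exists k0, forall k, (k0 <= k)%N -> M < h k.
Proof.
exists (Num.bound (expR M)) => k k0.
rewrite -[M]expRK ltr_ln ?posrE ?expR_gt0 //.
apply: lt_le_trans (archi_boundP (expR_ge0 _)) _; rewrite ler_nat.
exact: leq_trans k0 (height_ge_index k).
Qed.

(** An approximation with parameter just below the height of [P k.+1] cannot improve on [P k], so
    the value of [P k] is at most that of the approximation. *)
Lemma log_value_ge : exists C k0, forall k, (k0 <= k)%N -> x * h k.+1 - C <= l k.
Proof.
have [X0 X01 HX0] := approximableP approx.
exists (x * ln 2), (Num.bound (X0 * 2)) => k k0.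
(* Halving makes the height strictly smaller than that of [P k.+1], at the cost of [x * ln 2]. *)
pose X : R := (height (P k.+1))%:R / 2.
have Xle : X0 <= X.
  rewrite ler_pdivlMr //; apply: ltW; apply: lt_le_trans (archi_boundP _) _.
    by rewrite mulr_ge0 // (le_trans ler01).
  by rewrite ler_nat (leq_trans k0) // (leq_trans _ (height_ge_index _)).
have X_gt0 : 0 < X by rewrite divr_gt0.
have [Q [Q0 sQ hQ vQ]] := HX0 _ Xle.
have le : `|value xi (P k)| <= X `^ (- x).
  apply: le_trans vQ; rewrite leNgt; apply/negP => lt.
  case: minP => _ _ _ /(_ k Q Q0 sQ lt); rewrite -(ler_nat R) => hPQ.
  have : (height (P k.+1))%:R <= X by apply: le_trans hQ.
  apply/negP; rewrite -ltNge ltr_pdivrMr // ltr_pMr // ltr1n //.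
have : ln `|value xi (P k)| <= ln (X `^ (- x)) by rewrite ler_ln ?posrE // powR_gt0.
rewrite ln_powR ln_div ?posrE // -/(h k.+1) /l.
by move: (ln `|_|) (h _) (ln 2) => a b c; lra.
Qed.

(** A smaller degree or a proper common factor gives the product. If [P k] divides [P k.+1] in full
    degree, both are constant multiples of one primitive polynomial, and height and value could not
    move in opposite directions. *)
Let factor_or_coprime k :
  (exists A B, [/\ P k = A * B, A != 0, B != 0, (size A <= p.+1)%N & (size B <= p.+1)%N])
  \/ (size (P k) = p.+2 /\ coprimep (P k) (P k.+1)).
Proof.
have := P_size k; rewrite leq_eqVlt ltnS => /predU1P[sP|sP]; last first.
  by left; exists (P k), 1; rewrite mulr1 oner_neq0 size_poly1; split.
have [cP|ncP] := boolP (coprimep (P k) (P k.+1)); [by right|left].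
have G1 := dvdp_gcdl (P k) (P k.+1); have G2 := dvdp_gcdr (P k) (P k.+1).
move: ncP; rewrite /coprimep; set G := gcdp _ _ in G1 G2 * => nG.
have G0 : (0 < size G)%N by rewrite size_poly_gt0 gcdp_eq0 negb_and P_neq0.
have GP := dvdp_leq (P_neq0 k) G1.
have [eG|neG] := eqVneq (size G) (size (P k)); last first.
  have [|A [B [eQ A0 B0 sA sB]]] := @proper_factor _ _ (P_neq0 k) G1.
    by apply/andP; split; rewrite ltn_neqAle; [rewrite eq_sym nG | rewrite neG].
  by exists A, B; split=> //; rewrite -ltnS -sP.
have PP : P k %| P k.+1 by move/eqP: eG; rewrite (dvdp_size_eqp G1) => /eqp_dvdl <-.
have [r er] := dvdpP_int PP; set Z := zprimitive (P k) in er.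
have Z0 : Z != 0 by rewrite zprimitive_eq0.
have r0 : r != 0 by apply: contraNneq (P_neq0 k.+1) => r0; rewrite er r0 mulr0.
have /size1_polyC rC : (size r <= 1)%N.
  have := P_size k.+1; rewrite er size_mul // size_zprimitive sP addSn /=.
  by rewrite -[p.+2]addn1 leq_add2l.
have eP := zpolyEprim (P k); rewrite -/Z in eP; move: (zcontents _) eP => z eP.
rewrite rC mulrC mul_polyC in er; move: r`_0 er => c er.
case: minP => _ /(_ k) vP /(_ k) hP _; exfalso.
move: hP; rewrite er eP !heightZ ltn_mul2r height_gt0 //= => zc.
move: vP; rewrite er eP !valueZ !normrM ltr_pM2r ?normr_gt0 ?value_neq0 //.
by rewrite -!intr_norm -!abszE ltr_nat; move: zc; lia.
Qed.

(** A product of two factors of degree at most p has [l k <= (p + p)%:R * h k + O(1)], which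
    contradicts [l k >= x * h k.+1 - O(1)] for large [k] since x > 2 p. *)
Lemma eventually_coprime : exists k0, forall k, (k0 <= k)%N ->
  size (P k) = p.+2 /\ coprimep (P k) (P k.+1).
Proof.
have [c c0 Hc] := low_degree_value_ge tr px approx.
have [c' c'0 Hc'] := @product_value_ge R xi p (p + p) c c0.
have [C [k1 HC]] := log_value_ge.
have [k2 Hk2] := log_height_unbounded ((C - ln c') / (x - (p + p)%:R)).
exists (maxn k1 k2) => k; rewrite geq_max => /andP[kk1 kk2].
case: (factor_or_coprime k) => // -[A [B [eP A0 B0 sA sB]]]; exfalso.
have := Hc' A B A0 B0 sA sB (Hc _ A0 sA) (Hc _ B0 sB); rewrite -eP.
rewrite -ler_ln ?posrE ?mulr_gt0 ?exprn_gt0 // lnM ?posrE ?exprn_gt0 // ln_exprn //.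
have := HC _ kk1; have := Hk2 _ kk2; have := log_height_lt k.
rewrite ltr_pdivrMr ?subr_gt0 // -/(h k) /l.
move: px x_gt0; move: (p + p)%:R (ln c') (ln `|_|) (h k) (h k.+1) => e a b u w.
move=> ex x0 uw H1 H2 H3; have : x * u <= x * w by rewrite ler_pM2l // ltW.
by lra.
Qed.

(** The ratio of value to height decreases along the sequence, so that of the earliest polynomial is
    the common [t] in the determinant inequalities. *)
Let ratio_ge k j : (k <= j)%N ->
  `|value xi (P j)| <= `|value xi (P k)| / (height (P k))%:R * (height (P j))%:R.
Proof.
move=> kj; apply: le_trans (value_homo kj) _.
rewrite -mulrA ler_peMr // mulrC ler_pdivlMr // mul1r ler_nat.
exact: height_homo.
Qed.

Let log_ge0 (a b L H Y : R) : 0 < a -> 0 < b -> 0 < L -> 0 < H -> 0 < Y ->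
  1 <= a * (b * (L / H)) * Y -> 0 <= ln a + ln b + ln L - ln H + ln Y.
Proof.
move=> a0 b0 L0 H0 Y0.
have LH : 0 < L / H by rewrite divr_gt0.
move/ln_ge0; rewrite lnM ?posrE ?mulr_gt0 ?invr_gt0 //.
rewrite lnM ?posrE ?mulr_gt0 ?invr_gt0 //.
by rewrite lnM ?posrE // ln_div ?posrE // !addrA.
Qed.

Let xi1_gt0 m : 0 < (1 + `|xi|) ^+ m.
Proof. by rewrite exprn_gt0 // ltr_pwDl. Qed.

Let fact_gt0R m : 0 < m`!%:R :> R.
Proof. by rewrite ltr0n fact_gt0. Qed.

(** Resultant of [P k] and [P k.+1]: both heights have exponent p + 1, and dividing by the height of
    [P k] in [t] lowers the first one to p. *)
Lemma log_value_le : exists C k0, forall k, (k0 <= k)%N ->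
  l k <= p%:R * h k + p.+1%:R * h k.+1 + C.
Proof.
have [k0 Hk0] := eventually_coprime.
exists (ln (p.+1 + p.+1)`!%:R + ln ((1 + `|xi|) ^+ (p.+1 + p.+1))), k0 => k kk0.
set D := (1 + `|xi|) ^+ _; have D0 : 0 < D := xi1_gt0 _.
have [sP cP] := Hk0 _ kk0.
have := @resultant_le R xi p.+1 p.+1 (P k) (P k.+1) (height (P k))%:R
  (height (P k.+1))%:R (`|value xi (P k)| / (height (P k))%:R).
move=> /(_ isT cP sP (P_size _) (lexx _) (lexx _) (ratio_ge (leqnn _)) (ratio_ge (leqnSn _))).
rewrite -/D; move/log_ge0 => /(_ (fact_gt0R _) D0 (value_gt0 _) (heightR_gt0 _)).
rewrite mulr_gt0 ?exprn_gt0 // lnM ?posrE ?exprn_gt0 // !ln_exprn // => /(_ isT).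
rewrite -/(h k) -/(h k.+1) /l -natr1.
move: (ln `|_|) (h k) (h k.+1) (ln D) (ln _`!%:R) p%:R => a b c d e f.
by lra.
Qed.

(** The earliest polynomial comes last, in the role of [T]: its single row then cancels the height
    in the denominator of [t]. *)
Definition free_at k := int_free3 (P k.+1) (P k.+2) (P k).

Lemma free_log_value_le : exists C k0, forall k, (k0 <= k)%N -> free_at k ->
  l k <= p%:R * (h k.+1 + h k.+2) + C.
Proof.
have [k0 Hk0] := eventually_coprime.
exists (ln (p + p + 1)`!%:R + ln ((1 + `|xi|) ^+ (p + p + 1))), k0 => k kk0 fk.
set D := (1 + `|xi|) ^+ _; have D0 : 0 < D := xi1_gt0 _.
have [sP cP] := Hk0 _ (leqW kk0).
have := @triple_le R xi p (P k.+1) (P k.+2) (P k) (height (P k.+1))%:R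
  (height (P k.+2))%:R (height (P k))%:R (`|value xi (P k)| / (height (P k))%:R).
move=> /(_ p0 cP sP (P_size _) (P_size _) fk (lexx _) (lexx _) (lexx _)).
move=> /(_ (ratio_ge (leqnSn _)) (ratio_ge (leqW (leqnSn _))) (ratio_ge (leqnn _))).
rewrite -/D; move/log_ge0 => /(_ (fact_gt0R _) D0 (value_gt0 _) (heightR_gt0 _)).
rewrite !mulr_gt0 ?exprn_gt0 // lnM ?posrE ?mulr_gt0 ?exprn_gt0 //.
rewrite lnM ?posrE ?exprn_gt0 // !ln_exprn // => /(_ isT).
rewrite -/(h k) -/(h k.+1) -/(h k.+2) /l.
move: (ln `|_|) (h k) (h k.+1) (h k.+2) (ln D) (ln _`!%:R) p%:R => a b c c' d e f.
by lra.
Qed.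

(** * Runs of minimal polynomials lying in one plane *)

Lemma consecutive_free : exists k0, forall k, (k0 <= k)%N -> forall a b : int,
  a *: P k + b *: P k.+1 = 0 -> a = 0 /\ b = 0.
Proof.
have [k0 Hk0] := eventually_coprime; exists k0 => k kk0 a b e.
have [sP cP] := Hk0 _ kk0.
have [||a0 b0] := @coprime_rel_eq0 (P k) (P k.+1) a%:P b%:P cP.
- by rewrite sP (leq_ltn_trans (size_polyC_leq1 _)).
- by rewrite !mul_polyC.
by split; apply/eqP; rewrite -polyC_eq0; apply/eqP.
Qed.

(** This is coefficient m of P_k(xi) P_{k+1} - P_{k+1}(xi) P_k, which depends only on the wedge
    product of P_k and P_{k+1}. *)
Let Dc k m : R := value xi (P k) * ((P k.+1)`_m)%:~R - value xi (P k.+1) * ((P k)`_m)%:~R.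

Lemma centered_division (a b : int) : b != 0 -> exists m : int, 2 * `|a - m * b| <= `|b|.
Proof.
move=> b0; have := divz_eq a b; have := modz_ge0 a b0; have := ltz_mod a b0.
set q := (a %/ b)%Z; set r := (a %% b)%Z => rb r0 e.
have [|lt] := leP (2 * r) `|b|; first by exists q; rewrite e; lia.
by exists (q + Num.sg b); rewrite e mulrDl; have := numEsg b; lia.
Qed.

(** Rounding the coefficients of the dependence to nearest integers gives [Q] with value below that
    of [P k] and height below that of [P k.+1]; minimality forces Q = 0. Hence [P k.+2] is an
    integer combination of [P k] and [P k.+1], and [Dc] is multiplied by the nonzero integer
    [mc]. *)
Lemma wedge_le k : (forall a b : int, a *: P k + b *: P k.+1 = 0 -> a = 0 /\ b = 0) ->
  (forall a b : int, a *: P k.+1 + b *: P k.+2 = 0 -> a = 0 /\ b = 0) ->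
  ~ free_at k -> forall m, `|Dc k m| <= `|Dc k.+1 m|.
Proof.
move=> free0 free1 /existsNP[a] /existsNP[b] /existsNP[c] /not_implyP[e nz] m.
have b0 : b != 0.
  apply/eqP => b0; apply: nz; move: e; rewrite b0 scale0r addr0 addrC => /free0[-> ->].
  by [].
have [ma Hma] := centered_division a b0; have [mc Hmc] := centered_division c b0.
pose Q := P k.+2 + mc *: P k + ma *: P k.+1.
have bQ : b *: Q = (mc * b - c) *: P k + (ma * b - a) *: P k.+1.
  have -> : b *: Q = (a *: P k.+1 + b *: P k.+2 + c *: P k) +
     ((mc * b - c) *: P k + (ma * b - a) *: P k.+1).
    by rewrite /Q -!mul_polyC !polyCB !polyCM; ring.
  by rewrite e add0r.
have half (w a' mm : int) (u : R) : 0 <= u -> 2 * `|a' - mm * w| <= `|w| ->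
    `|(mm * w - a')%:~R| * u <= `|w%:~R| / 2 * u.
  move=> u0 H; rewrite ler_wpM2r // ler_pdivlMr // mulrC -!intr_norm -[2]/(2%:~R) -intrM.
  by rewrite ler_int distrC.
have bR : 0 < `|b%:~R : R| by rewrite normr_gt0 intr_eq0.
case: minP => _ vP hP Pmin.
have Q0 : Q = 0.
  apply/eqP/negPn/negP => Q0.
  have sQ : (size Q <= p.+2)%N.
    rewrite /Q; apply: leq_trans (size_polyD _ _) _; rewrite geq_max.
    apply/andP; split; last exact: leq_trans (size_scale_leq _ _) _.
    apply: leq_trans (size_polyD _ _) _; rewrite geq_max P_size /=.
    exact: leq_trans (size_scale_leq _ _) _.
  have vQ : `|value xi Q| < `|value xi (P k)|.
    rewrite -(ltr_pM2l bR) -normrM -valueZ bQ valueD !valueZ.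
    apply: le_lt_trans (ler_normD _ _) _; rewrite !normrM.
    apply: le_lt_trans (lerD (half _ _ _ _ _ Hmc) (half _ _ _ _ _ Hma)) _ => //.
    rewrite -mulrDr -mulrA ltr_pM2l // mulrC ltr_pdivrMr //.
    by have := vP k; move: `|value xi _| `|value xi _| => u w; lra.
  have := Pmin k Q Q0 sQ vQ; rewrite leqNgt => /negP; apply.
  have [j ej] := height_attained Q0.
  rewrite -(ltr_nat R) -(ltr_pM2l bR) -ej -[(absz _)%:R]/((absz _)%:Z%:~R) abszE intr_norm.
  rewrite -normrM -intrM -coefZ bQ coefD !coefZ intrD !intrM.
  apply: le_lt_trans (ler_normD _ _) _; rewrite !normrM.
  apply: le_lt_trans (lerD (half _ _ _ _ _ Hmc) (half _ _ _ _ _ Hma)) _ => //.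
  rewrite -mulrDr -mulrA ltr_pM2l // mulrC ltr_pdivrMr //.
  have := normr_coef_le R (P k) j; have := normr_coef_le R (P k.+1) j.
  have := hP k; rewrite -(ltr_nat R).
  by move: (height _)%:R (height _)%:R `|_%:~R| `|_%:~R| => u w u' w'; lra.
have eP : P k.+2 = - mc *: P k - ma *: P k.+1.
  by move/eqP: Q0; rewrite /Q -addrA addr_eq0 => /eqP->; rewrite opprD scaleNr.
have mc0 : mc != 0.
  apply/eqP => mc0; have [|_ //] := free1 ma 1.
  by rewrite eP mc0 oppr0 scale0r add0r scale1r subrr.
have -> : Dc k.+1 m = mc%:~R * Dc k m.
  rewrite /Dc eP valueB !valueZ coefB !coefZ intrB !intrM !intrN; ring.
by rewrite normrM ler_peMl // ge1_normr_intr.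
Qed.

Lemma wedge_upper k m :
  `|Dc k m| <= 2 * (`|value xi (P k)| * (height (P k.+1))%:R).
Proof.
apply: le_trans (ler_normB _ _) _; rewrite mulrDl mul1r !normrM.
apply: lerD; first by rewrite ler_wpM2l // normr_coef_le.
apply: ler_pM => //; first exact: value_homo.
by apply: le_trans (normr_coef_le R _ _) _; rewrite ler_nat height_homo.
Qed.

(** If the value at least halves from [P k] to [P k.+1], the largest coefficient of [P k.+1]
    dominates. Otherwise [P k.+1] is replaced by the difference or sum of the two polynomials, which
    has the same wedge up to sign. *)
Lemma wedge_lower k : exists m,
  `|value xi (P k)| * (height (P k.+1))%:R <= 2 * `|Dc k m|.
Proof.
case: minP => _ /(_ k) vP /(_ k) hP /(_ k) Pmin.
move: hP; rewrite -(ltr_nat R) => hP.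
have attained Q : Q != 0 -> exists m, `|(Q`_m)%:~R| = (height Q)%:R :> R.
  by move=> /height_attained[m <-]; exists m; rewrite -intr_norm -abszE.
have [le|gt] := leP (2 * `|value xi (P k.+1)|) `|value xi (P k)|.
  have [m em] := attained _ (P_neq0 k.+1); exists m.
  have : `|value xi (P k) * ((P k.+1)`_m)%:~R|
         <= `|Dc k m| + `|value xi (P k.+1) * ((P k)`_m)%:~R|.
    by rewrite -[X in `|X| <= _](subrK (value xi (P k.+1) * ((P k)`_m)%:~R)) ler_normD.
  rewrite !normrM em.
  have : 2 * `|value xi (P k.+1)| * `|((P k)`_m)%:~R| <=
         `|value xi (P k)| * (height (P k.+1))%:R.
    apply: ler_pM => //.
    by apply: le_trans (normr_coef_le R _ _) (ltW hP).
  by move: (`|Dc _ _|) => D; move: (_ * (height _)%:R) => u; lra.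
(* The sign [s] aligns the two values, so that subtraction leaves less than half of the first. *)
have [s s1 es] : exists2 s : int, (s * s = 1) &
    `|value xi (P k) - s%:~R * value xi (P k.+1)| =
    `|value xi (P k)| - `|value xi (P k.+1)|.
  move: vP; move: (value xi (P k)) (value xi (P k.+1)) => a b ab.
  have [a0|a0] := leP 0 a; have [b0|b0] := leP 0 b.
  - exists 1 => //; rewrite mul1r; move: ab.
    rewrite (ger0_norm a0) (ger0_norm b0) => ab; rewrite ger0_norm; lra.
  - exists (-1) => //; rewrite mulN1r; move: ab.
    rewrite (ger0_norm a0) (ltr0_norm b0) => ab; rewrite ger0_norm; lra.
  - exists (-1) => //; rewrite mulN1r; move: ab.
    rewrite (ltr0_norm a0) (ger0_norm b0) => ab; rewrite ler0_norm; lra.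
  - exists 1 => //; rewrite mul1r; move: ab.
    rewrite (ltr0_norm a0) (ltr0_norm b0) => ab; rewrite ler0_norm; lra.
pose Q := P k - s *: P k.+1.
have vQ : `|value xi Q| = `|value xi (P k)| - `|value xi (P k.+1)|.
  by rewrite valueB valueZ.
have Q0 : Q != 0.
  apply/eqP => Q0; move: vQ; rewrite Q0 /value rmorph0 horner0 normr0 -/(value _ _).
  move/esym/eqP; rewrite subr_eq0 => /eqP e; move: vP; rewrite /value.
  by rewrite -/(value xi (P k)) -/(value xi (P k.+1)) e ltxx.
have sQ : (size Q <= p.+2)%N.
  apply: leq_trans (size_polyD _ _) _; rewrite geq_max P_size size_polyN /=.
  exact: leq_trans (size_scale_leq _ _) _.
(* [Q] improves on [P k], so minimality keeps its height at least that of [P k.+1]. *)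
have hQ : (height (P k.+1) <= height Q)%N.
  by apply: Pmin => //; rewrite vQ ltrBlDr ltrDl.
have [m em] := attained _ Q0; exists m.
have eD : s%:~R * Dc k m = value xi Q * ((P k)`_m)%:~R - value xi (P k) * (Q`_m)%:~R.
  have sR : s%:~R * s%:~R = 1 :> R by rewrite -intrM s1.
  rewrite /Dc /Q valueB valueZ coefB coefZ intrB intrM; ring.
have sN : `|s%:~R : R| = 1.
  have : `|s%:~R : R| * `|s%:~R| = 1 by rewrite -normrM -intrM s1 normr1.
  by move: (normr_ge0 (s%:~R : R)); move: `|_| => y; nra.
have {}eD : `|Dc k m| = `|value xi Q * ((P k)`_m)%:~R - value xi (P k) * (Q`_m)%:~R|.
  by rewrite -eD normrM sN mul1r.
have : `|value xi (P k) * (Q`_m)%:~R| <= `|Dc k m| + `|value xi Q * ((P k)`_m)%:~R|.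
  rewrite eD distrC.
  by rewrite -[X in `|X| <= _](subrK (value xi Q * ((P k)`_m)%:~R)) ler_normD.
rewrite !normrM em vQ.
have : 2 * (`|value xi (P k)| - `|value xi (P k.+1)|) * `|((P k)`_m)%:~R| <=
       `|value xi (P k)| * (height (P k.+1))%:R.
  apply: ler_pM => //; first by rewrite -vQ.
    by move: gt; move: `|_| `|_| => u w; lra.
  by apply: le_trans (normr_coef_le R _ _) (ltW hP).
have : `|value xi (P k)| * (height (P k.+1))%:R <= `|value xi (P k)| * (height Q)%:R.
  by rewrite ler_wpM2l // ler_nat.
move: (`|Dc _ _|) (_ * (height (P k.+1))%:R) (_ * (height Q)%:R) => D u w.
by move: (_ - _) => y; lra.
Qed.

(** One coefficient of the wedge is followed from i to j: it is large at i, does not decrease in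
    absolute value at non-free indices, and is bounded above at j. The two factors 2 make up
    [ln 4]. *)
Lemma non_free_log_value_le : exists k0, forall i j, (k0 <= i <= j)%N ->
  (forall k, (i <= k < j)%N -> ~ free_at k) ->
  l j - h j.+1 <= l i - h i.+1 + ln 4.
Proof.
have [k0 Hk0] := consecutive_free; exists k0 => i j /andP[ki ij] nf.
have [m Hm] := wedge_lower i.
have mono : `|Dc i m| <= `|Dc j m|.
  move: nf; move: ij => /subnK <-; elim: (j - i)%N => // d IHd nf.
  apply: le_trans (IHd _) _.
    by move=> k /andP[ik kd]; apply: nf; rewrite ik addSn ltnS ltnW.
  have kd : (k0 <= d + i)%N by rewrite (leq_trans ki) // leq_addl.
  apply: wedge_le; [exact: Hk0|by apply: Hk0; apply: leqW|].
  by apply: nf; rewrite leq_addl addSn ltnS leqnn.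
have : `|value xi (P i)| * (height (P i.+1))%:R <=
       4 * (`|value xi (P j)| * (height (P j.+1))%:R).
  apply: le_trans Hm _; have := wedge_upper j m; move: mono.
  by move: `|Dc i m| `|Dc j m| (`|value xi (P j)| * _) => a b c; lra.
rewrite -ler_ln ?posrE ?mulr_gt0 // [X in _ <= X]lnM ?posrE ?mulr_gt0 //.
rewrite !lnM ?posrE // -/(h i.+1) -/(h j.+1) /l.
by move: (ln `|_|) (ln `|_|) (h _) (h _) (ln 4) => a b c d e; lra.
Qed.

(** Otherwise [l j - h j.+1] would stay bounded above, whereas it is at least
    [(x - 1) * h j.+1 - O(1)] with x > 1. *)
Lemma infinitely_many_free k0 : exists2 k, (k0 <= k)%N & free_at k.
Proof.
apply: contrapT => nf.
have [k1 Hk1] := non_free_log_value_le; have [C [k2 HC]] := log_value_ge.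
pose i := maxn k0 (maxn k1 k2).
have [k3 Hk3] := log_height_unbounded ((l i - h i.+1 + ln 4 + C) / (x - 1)).
pose j := maxn i k3.
have ij : (i <= j)%N by rewrite leq_maxl.
have : l j - h j.+1 <= l i - h i.+1 + ln 4.
  apply: Hk1; first by rewrite ij andbT !leq_max leqnn orbT.
  move=> k /andP[ik _] fk; apply: nf; exists k => //.
  by apply: leq_trans ik; rewrite leq_maxl.
have : x * h j.+1 - C <= l j by apply: HC; apply: leq_trans ij; rewrite !leq_max leqnn !orbT.
have : (l i - h i.+1 + ln 4 + C) / (x - 1) < h j.+1.
  by apply: Hk3; rewrite leqW // leq_maxr.
rewrite ltr_pdivrMr ?subr_gt0 ?x_gt1 //.
move: (l i - h i.+1 + ln 4) (h j.+1) (l j) => a b c.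
by rewrite mulrBr mulr1 [b * x]mulrC; lra.
Qed.

(** * The bound in general degree *)

Lemma log_height_ratio_le : exists C k0, forall k, (k0 <= k)%N ->
  (x - p.+1%:R) * h k.+1 <= p%:R * h k + C.
Proof.
have [C1 [k1 H1]] := log_value_ge; have [C2 [k2 H2]] := log_value_le.
exists (C1 + C2), (maxn k1 k2) => k; rewrite geq_max => /andP[/H1 + /H2].
by rewrite mulrBl; lra.
Qed.

Lemma general_bound : (x - p.+1%:R) * (x - p.+1%:R + 1) <= p%:R ^+ 2.
Proof.
have [C1 [k1 H1]] := log_value_ge; have [C2 [k2 H2]] := free_log_value_le.
have [C3 [k3 H3]] := log_height_ratio_le.
set y := x - p.+1%:R.
have y0 : 0 < y.
  rewrite subr_gt0; apply: le_lt_trans px; rewrite ler_nat -addn1 leq_add2l //.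
rewrite leNgt; apply/negP => gt.
(* Eliminating [h k.+2] and [l k] at a free index bounds [h k.+1] by this quotient; beyond [k4] that
   is impossible. *)
have [k4 H4] := log_height_unbounded
  ((y * (C1 + C2) + p%:R * C3) / (y * (y + 1) - p%:R ^+ 2)).
have [k kk fk] := infinitely_many_free (maxn (maxn k1 k2) (maxn k3 k4)).
move: kk; rewrite !geq_max => /andP[/andP[/H1 E1 /H2/(_ fk) E2] /andP[kk3 kk4]].
have := H3 _ (leqW kk3); have := H4 _ (leqW kk4).
rewrite ltr_pdivrMr ?subr_gt0 // -/y => E4 E3.
have p1 : 0 <= p%:R :> R by [].
have xy : x = y + p%:R + 1 by rewrite /y -natr1; lra.
move: E1 E2 E3 E4; rewrite xy; move: (h k.+1) (h k.+2) (l k) => a b c E1 E2 E3 E4.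
have F1 : (y + 1) * a <= p%:R * b + (C1 + C2) by lra.
have F2 : y * ((y + 1) * a) <= y * (p%:R * b + (C1 + C2)) by rewrite ler_pM2l.
have F3 : p%:R * (y * b) <= p%:R * (p%:R * a + C3) by rewrite ler_wpM2l.
by rewrite expr2 in E4; lra.
Qed.

(** * The sharper bound in degree three *)

Hypothesis p2 : p = 2%N.

Let size4 k : (size (P k) <= 4)%N. Proof. by have := P_size k; rewrite {1}p2. Qed.

Let triple k (t : 'I_3) : {poly int} := nth 0 [:: P k; P k.+1; P k.+2] t.

Let triple_free k : free_at k -> int_free (triple k).
Proof.
move=> fk c; rewrite !big_ord_recl big_ord0 /= addr0 => e.
have [] := fk (c (lift ord0 ord0)) (c (lift ord0 (lift ord0 ord0))) (c ord0).
  by rewrite -[RHS]e addrC.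
move=> c1 c2 c0 i; case: (unliftP ord0 i) => [i1|] -> //.
case: (unliftP ord0 i1) => [i2|] -> //.
by rewrite (ord1 i2).
Qed.

Let triple_index k (t : 'I_3) : exists2 j, (k <= j <= k.+2)%N & triple k t = P j.
Proof.
case: t => -[|[|[|//]]] /= ?; [exists k|exists k.+1|exists k.+2] => //; lia.
Qed.

Let mem_triple k j : (k <= j <= k.+2)%N -> in_span (triple k) (P j).
Proof.
move=> kj; have kj3 : (j - k < 3)%N by lia.
have -> : P j = triple k (Ordinal kj3).
  rewrite /triple /=; have -> : j = (j - k + k)%N by lia.
  by rewrite addnK; move: kj3; case: (j - k)%N => [|[|[|]]].
exact: in_span_gen.
Qed.

Let in_span_trans (I J : finType) (F : I -> {poly int}) (G : J -> {poly int}) Q :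
  in_span F Q -> (forall i, in_span G (F i)) -> in_span G Q.
Proof.
move=> [c [e c0 eQ]] FG.
have [c' [e' c'0 eQ']] : in_span G (c *: Q).
  rewrite eQ; apply: (big_ind (in_span G)) => [|A B|i _];
    [exact: in_span0 | exact: in_spanD | exact: in_spanZ].
by exists (c' * c), e'; rewrite ?mulf_neq0 // -scalerA.
Qed.

(** Four independent polynomials of degree at most 3 already give a square determinant, without
    shifts. *)
Lemma quadruple_log_value_le : exists C, forall i j, (i <= j)%N ->
  free_at i -> ~ in_span (triple i) (P j) ->
  l i <= h i.+1 + h i.+2 + h j + C.
Proof.
(* The summand [ln 1] stands where a power of [1 + |xi|] occurs in the shifted families, so that
   [log_ge0] applies unchanged. *)
exists (ln 4`!%:R + ln 1) => i j ij fi nj.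
pose F (t : 'I_3 + 'I_1) := match t with inl t => triple i t | inr _ => P j end.
have fF : int_free F.
  move=> c; rewrite big_sumType big_ord1 /= => e.
  have c0 : c (inr ord0) = 0.
    apply/eqP/negPn/negP => c0; apply: nj.
    exists (c (inr ord0)), (fun t => - c (inl t)) => //.
    under eq_bigr do rewrite scaleNr.
    by rewrite sumrN; apply/eqP; rewrite -addr_eq0 addrC e.
  move: e; rewrite c0 scale0r addr0 => /(triple_free fi) cl [] t //.
  by rewrite (ord1 t).
pose H (t : 'I_3 + 'I_1) : R := (height (F t))%:R.
have Fj t : exists2 k, (i <= k)%N & F t = P k.
  case: t => t /=; last by exists j.
  by have [k /andP[ik _] ->] := triple_index i t; exists k.
have : 1 <= 4`!%:R * (1 * (`|value xi (P i)| / (height (P i))%:R)) *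
    ((height (P i))%:R * ((height (P i.+1))%:R * (height (P i.+2))%:R) *
     (height (P j))%:R).
  have := @free_value_le R xi ('I_3 + 'I_1)%type F H
    (1 * (`|value xi (P i)| / (height (P i))%:R)).
  rewrite card_sum !card_ord big_sumType big_ord1 !big_ord_recl big_ord0 /= mulr1.
  apply=> //.
  - by move=> t; have [k _ ->] := Fj t; apply: size4.
  - by move=> t; rewrite mul1r /H; have [k ik ->] := Fj t; apply: ratio_ge.
move/log_ge0 => /(_ (fact_gt0R _) ltr01 (value_gt0 _) (heightR_gt0 _)).
rewrite !mulr_gt0 // => /(_ isT).
rewrite lnM ?posrE ?mulr_gt0 // lnM ?posrE ?mulr_gt0 // lnM ?posrE //.
rewrite -/(h i) -/(h i.+1) -/(h i.+2) -/(h j) /l.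
by move: (ln 4`!%:R) (ln 1) (ln `|_|) => a b c; lra.
Qed.

Let y := x - 3.
Let y_gt1 : 1 < y.
Proof. by move: px; rewrite p2 /y; lra. Qed.

Let ratio2 : exists C k0, forall k, (k0 <= k)%N -> y * h k.+1 <= 2 * h k + C.
Proof. by have := log_height_ratio_le; rewrite {1 2}p2. Qed.

(** If all later polynomials stayed in a three-dimensional space, its 3 by 3 determinants would give
    [l k <= h k.+1 + h k.+2 + O(1)] at free indices. With [ratio2] this yields y (y + 2) <= 2,
    against y > 1. *)
Lemma leaves_triple_span i : free_at i -> exists2 j, (i <= j)%N & ~ in_span (triple i) (P j).
Proof.
move=> fi; apply: contrapT => all_in.
have {}all_in j : (i <= j)%N -> in_span (triple i) (P j).
  by move=> ij; apply: contrapT => nj; apply: all_in; exists j.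
have s3 k t : (size (triple k t) <= 4)%N by have [j _ ->] := triple_index k t; apply: size4.
have [K K0 HK] := @subspace_value_le 4 R xi 2 (triple i) tr (s3 i) (triple_free fi).
have [C1 [k1 H1]] := log_value_ge; have [C3 [k3 H3]] := ratio2.
have [k4 H4] := log_height_unbounded
  ((y * (C1 + (ln K + ln 1)) + C3) / (y * (y + 2) - 2)).
have [k kk fk] := infinitely_many_free (maxn (maxn k1 i) (maxn k3 k4)).
move: kk; rewrite !geq_max => /andP[/andP[/H1 E1 ik] /andP[kk3 kk4]].
have E2 : l k <= h k.+1 + h k.+2 + (ln K + ln 1).
  have : 1 <= K * (1 * (`|value xi (P k)| / (height (P k))%:R)) *
    ((height (P k))%:R * ((height (P k.+1))%:R * (height (P k.+2))%:R)).
    have := HK (triple k) (fun t => (height (triple k t))%:R)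
      (1 * (`|value xi (P k)| / (height (P k))%:R)) (s3 k) (triple_free fk).
    rewrite !big_ord_recl big_ord0 /= mulr1; apply=> //.
    - move=> t; have [j /andP[kj _] ->] := triple_index k t.
      by apply: all_in; apply: leq_trans kj.
    - move=> t; rewrite mul1r; have [j /andP[kj _] ->] := triple_index k t.
      exact: ratio_ge.
  move/log_ge0 => /(_ K0 ltr01 (value_gt0 _) (heightR_gt0 _)).
  rewrite !mulr_gt0 // => /(_ isT).
  rewrite lnM ?posrE ?mulr_gt0 // lnM ?posrE //.
  rewrite -/(h k) -/(h k.+1) -/(h k.+2) /l.
  by move: (ln K) (ln 1) (ln `|_|) => a b c; lra.
have E3 := H3 _ (leqW kk3); have := H4 _ (leqW kk4).
have y0 : 0 < y by apply: lt_trans y_gt1.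
have yy : 0 < y * (y + 2) - 2 by have := y_gt1; move: (y) => z; nra.
rewrite ltr_pdivrMr // => E4.
have xy : x = y + 3 by rewrite /y; lra.
move: E1 E2 E3 E4; rewrite xy.
move: (h k.+1) (h k.+2) (l k) (ln K + ln 1) => a b c d E1 E2 E3 E4.
have F1 : (y + 2) * a <= b + (C1 + d) by lra.
have F2 : y * ((y + 2) * a) <= y * (b + (C1 + d)) by rewrite ler_pM2l.
by lra.
Qed.

(* i is the last free index before the first j.+2 with P j.+2 outside the span of
   the triple at i, so only the plane of P i.+1 and P i.+2 occurs in between. *)
Lemma consecutive_free_triples k0 : exists i j, [/\ (k0 <= i < j)%N, free_at i,
  ~ in_span (triple i) (P j.+2) & forall k, (i < k < j)%N -> ~ free_at k].
Proof.
have [i0 ki0 fi0] := infinitely_many_free k0.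
have [j0 ij0 nj0] := leaves_triple_span fi0.
pose out j := (i0 <= j)%N && `[< ~ in_span (triple i0) (P j) >].
have ex_out : exists j, out j by exists j0; rewrite /out ij0; apply/asboolP.
case: (ex_minnP ex_out) => J /andP[iJ /asboolP nJ] Jmin.
have inJ k : (i0 <= k < J)%N -> in_span (triple i0) (P k).
  move=> /andP[ik kJ]; apply: contrapT => nk.
  have : (J <= k)%N by apply: Jmin; rewrite /out ik; apply/asboolP.
  by rewrite leqNgt kJ.
have J3 : (i0.+3 <= J)%N.
  by rewrite ltnNge; apply/negP => Ji; apply: nJ; apply: mem_triple; rewrite iJ.
pose ok i := [&& (i0 <= i)%N, (i.+3 <= J)%N & `[< free_at i >]].
have ex_ok : exists i, ok i by exists i0; apply/and3P; split=> //; apply/asboolP.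
have ok_le i : ok i -> (i <= J)%N by case/and3P => _ iJ3 _; lia.
case: (ex_maxnP ex_ok ok_le) => i /and3P[i0i iJ3 /asboolP fi] imax.
exists i, (J - 2)%N; have eJ : ((J - 2).+2 = J)%N by lia.
rewrite eJ; split=> //; first by lia.
(* The triple at [i] ends before [J], so it lies in the span of the triple at [i0], which does not
   contain [P J]. *)
- move=> nJi; apply: nJ; apply: in_span_trans nJi _ => t.
  have [k /andP[ik ki] ->] := triple_index i t.
  by apply: inJ; lia.
- move=> k /andP[ik kJ] fk.
  have : (k <= i)%N by apply: imax; apply/and3P; split; [lia|lia|apply/asboolP].
  by rewrite leqNgt ik.
Qed.

(** Four determinant estimates combine: the quadruple at i and j + 2, the resultant at i + 1 carried
    to j through the plane between, and the ratios of consecutive heights at i + 1 and j + 1. *)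
Lemma cubic_bound : (x - 3) ^+ 2 <= 2.
Proof.
have [C1 [k1 H1]] := log_value_ge; have [C2 [k2 H2]] := log_value_le.
have [C3 [k3 H3]] := ratio2; have [C4 H4] := quadruple_log_value_le.
have [k5 H5] := non_free_log_value_le.
rewrite -/y leNgt; apply/negP => y2.
have y0 : 0 < y by apply: lt_trans y_gt1.
(* These constants collect the error terms of the elimination; beyond [k6], [h i.+1] exceeds what
   the final inequality allows. *)
pose K1 := C1 + C4; pose K3 := C1 + C2 + ln 4.
pose K4 := 2 * K3 + (y + 2) * C3 + y * (y + 2) * K1.
pose K5 := (y * (y + 2) + 4) * C3 + y * K4.
have [k6 H6] := log_height_unbounded (K5 / ((y ^+ 2 - 2) * (y + 2) ^+ 2)).
pose k0 := maxn (maxn (maxn k1 k2) (maxn k3 k5)) k6.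
have [i [j [/andP[ki ij] fi nj nf]]] := consecutive_free_triples k0.
move: ki; rewrite !geq_max => /andP[/andP[/andP[ik1 ik2] /andP[ik3 ik5]] ik6].
have E1 := H1 _ ik1.
have E4 := H4 i j.+2 (leqW (leqW (ltnW ij))) fi nj.
have E2 := H2 _ (leqW ik2); rewrite {1 2}p2 in E2.
have E1j := H1 j (leq_trans ik1 (ltnW ij)).
have E3 := H3 _ (leqW ik3).
have E3j := H3 j.+1 (leq_trans ik3 (leqW (ltnW ij))).
have E5 : l j - h j.+1 <= l i.+1 - h i.+2 + ln 4.
  apply: H5; first by rewrite ij andbT leqW.
  by move=> k /andP[ik kj]; apply: nf; rewrite ik.
have := H6 _ (leqW ik6).
have y22 : 0 < (y ^+ 2 - 2) * (y + 2) ^+ 2.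
  by rewrite mulr_gt0 ?subr_gt0 // exprn_gt0 // addr_gt0.
rewrite ltr_pdivrMr // => E6.
have xy : x = y + 3 by rewrite /y; lra.
move: E1 E4 E2 E1j E3 E3j E5 E6; rewrite xy.
move: (h i.+1) (h i.+2) (h j.+1) (h j.+2) (l i) (l i.+1) (l j) => a b c d u v w.
move=> E1 E4 E2 E1j E3 E3j E5 E6.
have F1 : (y + 2) * a <= b + d + K1 by rewrite /K1; lra.
have F3 : (y + 2) * c <= 2 * a + 2 * b + K3 by rewrite /K3; lra.
have G1 : (y + 2) * (y * d) <= (y + 2) * (2 * c + C3) by rewrite ler_pM2l // addr_gt0.
have G2 : y * (y + 2) * ((y + 2) * a) <= y * (y + 2) * (b + d + K1).
  by rewrite ler_pM2l // mulr_gt0 // addr_gt0.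
have G3 : y * (y + 2) * ((y + 2) * a) <= (y * (y + 2) + 4) * b + 4 * a + K4.
  by rewrite /K4; lra.
have G4 : y * (y * (y + 2) * ((y + 2) * a)) <= y * ((y * (y + 2) + 4) * b + 4 * a + K4).
  by rewrite ler_pM2l.
have G5 : (y * (y + 2) + 4) * (y * b) <= (y * (y + 2) + 4) * (2 * a + C3).
  by rewrite ler_pM2l // addr_gt0 // mulr_gt0 // addr_gt0.
move: E6; rewrite /K5 !expr2; lra.
Qed.

End MinimalSequence.

(** * From quadratic inequalities to the closed forms *)

Lemma sqrt_bound_le (R : realType) (n x : R) : 0 <= n ^+ 2 - 2 * n + 5 / 4 ->
  n - 1 / 2 + Num.sqrt (n ^+ 2 - 2 * n + 5 / 4) < x ->
  (n - 1) ^+ 2 < (x - n) * (x - n + 1).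
Proof.
move=> s0; set s := Num.sqrt _ => sx.
have s_ge0 : 0 <= s by apply: sqrtr_ge0.
have s2 : s ^+ 2 = n ^+ 2 - 2 * n + 5 / 4 by apply: sqr_sqrtr.
(* Completing the square: (x - n)(x - n + 1) = (x - n + 1/2)^2 - 1/4 and s^2 - 1/4 = (n - 1)^2. *)
have : s ^+ 2 < (x - n + 1 / 2) ^+ 2 by apply: ltrXn2r => //; rewrite ?nnegrE //; lra.
by rewrite s2 !expr2; lra.
Qed.

Theorem theorem2p1 (R : realType) (xi : R) (hxi : transcendental xi) :
  (forall n : nat, (2 <= n)%N ->
     (uniform_exponent n xi <=
      (n%:R - 1 / 2%:R + Num.sqrt (n%:R ^+ 2 - 2%:R * n%:R + 5%:R / 4%:R))%:E)%E)
  /\ (uniform_exponent 3 xi <= (3%:R + Num.sqrt 2%:R)%:E)%E.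
Proof.
split=> [n n2|]; apply: ge_ereal_sup => _ [x approx <-]; rewrite lee_fin leNgt;
    apply/negP => bx.
  case: n n2 approx bx => [//|p] p0 approx bx.
  have pR : 1 <= p%:R :> R by rewrite ler1n.
  have s0 : 0 <= p.+1%:R ^+ 2 - 2 * p.+1%:R + 5 / 4 :> R by rewrite -natr1; nra.
  have := sqrt_bound_le s0 bx; have [px|px] := ltP (p + p)%:R x.
    have [P minP] := exists_minimal_sequence_uniform hxi p0 px approx.
    have := general_bound hxi p0 px approx minP.
    rewrite leNgt => /negP nb b; apply: nb; move: b.
    by rewrite -[in (p.+1%:R - 1) ^+ 2]natr1 addrK.
  (* Here x <= 2 p. The product (x - n)(x - n + 1) increases from x = n - 1/2 on, so it is at most
     (p - 1) p, below p^2. *)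
  have : p.+1%:R - 1 / 2 <= x by apply: ltW; apply: le_lt_trans bx; rewrite lerDl sqrtr_ge0.
  by move: px; rewrite natrD -natr1 => H1 H2; nra.
have s0 := sqrtr_ge0 (2%:R : R); have s2 := sqr_sqrtr (ler0n R 2).
(* The assumption x > 3 + sqrt 2 already gives x > 4. *)
have px : (2 + 2)%:R < x by rewrite natrD; nra.
have [P minP] := exists_minimal_sequence_uniform hxi (isT : (0 < 2)%N) px approx.
have := cubic_bound hxi (isT : (0 < 2)%N) px approx minP erefl.
by rewrite leNgt => /negP; apply; nra.
Qed.
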